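(* Let $M(n)$ denote the maximum, over all sets $A\subseteq[n]^2$ that percolate, of the time $A$ takes to percolate in $2$-neighbour bootstrap percolation on the $n\times n$ grid. Then $M(n)=\frac{13}{18}n^2+O(n)$ as $n\to\infty$.
   Context: The $n\times n$ grid $[n]^2$ has vertex set $\{(i,j):1\le i,j\le n\}$, two sites being adjacent if they are at $\ell_1$-distance $1$. In $2$-neighbour bootstrap percolation started from a set $A_0=A$ of initially infected sites, for $t\ge1$ one sets $A_t=A_{t-1}\cup\{v: v \text{ has at least } 2 \text{ neighbours in } A_{t-1}\}$. The set $A$ percolates if $\bigcup_t A_t$ is the whole vertex set; it then percolates in time $T$, where $T$ is the smallest number with $A_T$ equal to the whole vertex set. *)

(* Defs.v *)
From mathcomp Require Import all_boot all_order all_algebra.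
From mathcomp Require Import boolp.

Set Implicit Arguments.
Unset Strict Implicit.
Unset Printing Implicit Defensive.

(* Coordinates run over 0, ..., n-1 instead of 1, ..., n. *)
Definition site (n : nat) : finType := ('I_n * 'I_n)%type.

(* The truncated differences (a - b) + (b - a) add up to |a - b|. *)
Definition l1_dist (n : nat) (u v : site n) : nat :=
  ((u.1 - v.1) + (v.1 - u.1)) + ((u.2 - v.2) + (v.2 - u.2)).

Definition adjacent (n : nat) (u v : site n) : bool := l1_dist u v == 1.

Definition bootstrap_step (n : nat) (A : {set site n}) : {set site n} :=
  A :|: [set v | 2 <= #|[set w in A | adjacent v w]|].

Fixpoint infected (n : nat) (A : {set site n}) (t : nat) : {set site n} :=
  if t is t'.+1 then bootstrap_step (infected A t') else A.

Definition percolates (n : nat) (A : {set site n}) : Prop :=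
  forall v : site n, exists t : nat, v \in infected A t.

(* The value 0 in the second branch is never used for a percolating set: see
   percolates_ex and percolation_timeP below. *)
Definition percolation_time (n : nat) (A : {set site n}) : nat :=
  if pselect (exists t, infected A t == [set: site n]) is left ex_t
  then ex_minn ex_t else 0.

Definition max_percolation_time (n : nat) : nat :=
  \max_(A : {set site n} | `[< percolates A >]) percolation_time A.

Lemma infected_mono (n : nat) (A : {set site n}) (s t : nat) :
  s <= t -> infected A s \subset infected A t.
Proof.
move=> /subnK <-; elim: (t - s) => [|k IHk] //=.
exact: subset_trans IHk (subsetUl _ _).
Qed.

Lemma percolates_ex (n : nat) (A : {set site n}) :
  percolates A -> exists t, infected A t == [set: site n].
Proof.
move=> /choice[f Hf]; exists (\max_v f v).
rewrite eqEsubset subsetT /=; apply/subsetP => v _.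
by apply: (subsetP (infected_mono A (leq_bigmax v))).
Qed.

Lemma percolation_timeP (n : nat) (A : {set site n}) : percolates A ->
  infected A (percolation_time A) = [set: site n] /\
  (forall t, infected A t = [set: site n] -> percolation_time A <= t).
Proof.
move=> /percolates_ex exA; rewrite /percolation_time.
case: pselect => // e; case: ex_minnP => m /eqP Hm Hmin.
by split=> // t Ht; apply: Hmin; rewrite Ht.
Qed.

Lemma max_percolation_timeP (n : nat) :
  (exists A : {set site n},
      percolates A /\ percolation_time A = max_percolation_time n) /\
  (forall A : {set site n},
      percolates A -> percolation_time A <= max_percolation_time n).
Proof.
have pT : `[< percolates [set: site n] >].
  by apply/asboolP => v; exists 0; rewrite /= inE.
split.
  rewrite /max_percolation_time (bigmax_eq_arg _ pT).
  by case: arg_maxnP => // A /asboolP pA _; exists A.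
by move=> A pA; apply: (@leq_bigmax_cond _ _ _ A); apply/asboolP.
Qed.

(* Main.v *)
Require Import Defs.
From mathcomp Require Import all_boot all_order all_algebra.
From mathcomp Require Import all_classical all_reals all_analysis.
From mathcomp Require Import lra.
From Stdlib Require Import ZArith Lia Classical.
Import numFieldNormedType.Exports.

(* Upper bound. A rectangle spanned by the infection is the hull of two smaller spanned rectangles
   at distance at most 2, so the time needed for a k x l rectangle satisfies a recursion in (k, l):
   enlarging both sides costs max(k, l), adding at least two columns (rows) costs l (k). A single
   extra column also costs l, but the seed driving it must stay out of reach until the previous
   rectangle is complete; this forces the previous step to be a large one, and three columns cost
   2 l altogether. With F(k, l) = l k - k^2 / 2 if 3 k <= l and F(k, l) = 2 l k / 3 + l^2 / 18 if
   k <= l <= 3 k, every step costs at most the increase of F up to O(1) per unit of semiperimeter,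
   and F(n, n) = 13 n^2 / 18.

   Lower bound. Start with a segment of length 2 n / 3, enlarge both sides by one n / 3 times, then
   add columns in groups of three (two at once, then one), each group costing 2 n. *)

Local Open Scope Z_scope.

Definition region := Z -> Z -> Prop.

Definition two_neighbours (S : region) (x y : Z) : Prop :=
  (S (x - 1) y /\ S (x + 1) y) \/ (S x (y - 1) /\ S x (y + 1)) \/
  ((S (x - 1) y \/ S (x + 1) y) /\ (S x (y - 1) \/ S x (y + 1))).

Fixpoint evolve (S : region) (t : nat) : region :=
  if t is t'.+1 then
    fun x y => evolve S t' x y \/ two_neighbours (evolve S t') x y
  else S.

(* Times are integers so that all estimates are linear integer arithmetic; a negative
   time counts as 0. *)
Definition at_time (S : region) (T : Z) : region := evolve S (Z.to_nat T).

Lemma two_neighbours_mono (S S' : region) x y :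
  (forall u v, S u v -> S' u v) -> two_neighbours S x y -> two_neighbours S' x y.
Proof.
move=> sub; rewrite /two_neighbours.
have := sub (x - 1) y; have := sub (x + 1) y.
have := sub x (y - 1); have := sub x (y + 1); tauto.
Qed.

Lemma evolve_mono (S S' : region) t x y :
  (forall u v, S u v -> S' u v) -> evolve S t x y -> evolve S' t x y.
Proof.
move=> sub; elim: t x y => [|t IHt] x y /=; first exact: sub.
by case=> [/IHt|H]; [left | right; apply: two_neighbours_mono H].
Qed.

Lemma evolve_leq (S : region) s t x y : (s <= t)%nat -> evolve S s x y -> evolve S t x y.
Proof.
move=> /subnK <-; elim: (t - s)%nat => [//|k IHk] /IHk H.
by rewrite addSn; left.
Qed.

Lemma evolve_add (S : region) s t x y :
  evolve (evolve S s) t x y -> evolve S (s + t) x y.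
Proof.
elim: t x y => [|t IHt] x y; first by rewrite addn0.
rewrite addnS /= => -[/IHt|H]; [by left | right].
by apply: two_neighbours_mono H.
Qed.

Lemma at_time0 (S : region) T x y : S x y -> at_time S T x y.
Proof. exact: (@evolve_leq S 0). Qed.

Lemma at_time_le (S : region) T T' x y : T <= T' -> at_time S T x y -> at_time S T' x y.
Proof. by move=> le; apply: evolve_leq; apply/leP; lia. Qed.

Lemma at_time_mono (S S' : region) T x y :
  (forall u v, S u v -> S' u v) -> at_time S T x y -> at_time S' T x y.
Proof. exact: evolve_mono. Qed.

Lemma at_time_step (S : region) T x y :
  1 <= T -> two_neighbours (at_time S (T - 1)) x y -> at_time S T x y.
Proof.
move=> T1 H; rewrite /at_time.
have -> : Z.to_nat T = (Z.to_nat (T - 1)).+1 by lia.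
by right.
Qed.

Lemma at_time_add (S : region) T T' x y : 0 <= T -> 0 <= T' ->
  at_time (at_time S T) T' x y -> at_time S (T + T') x y.
Proof. by move=> T0 T'0 /evolve_add; rewrite /at_time Z2Nat.inj_add. Qed.

Definition flip (S : region) : region := fun x y => S (- x) y.
Definition swap (S : region) : region := fun x y => S y x.

Lemma evolve_flip (S : region) t x y : evolve (flip S) t x y <-> evolve S t (- x) y.
Proof.
elim: t x y => [|t IHt] x y //=.
rewrite /two_neighbours !IHt.
have -> : - (x - 1) = - x + 1 by lia.
have -> : - (x + 1) = - x - 1 by lia.
tauto.
Qed.

Lemma evolve_swap (S : region) t x y : evolve (swap S) t x y <-> evolve S t y x.
Proof.
by elim: t x y => [|t IHt] x y //=; rewrite /two_neighbours !IHt; tauto.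
Qed.

Record rect := Rect { left_ : Z; right_ : Z; bot : Z; top : Z }.

Definition inside (Q : rect) : region := fun x y =>
  left_ Q <= x <= right_ Q /\ bot Q <= y <= top Q.

Definition width (Q : rect) : Z := right_ Q - left_ Q + 1.
Definition height (Q : rect) : Z := top Q - bot Q + 1.
Definition semiper (Q : rect) : Z := width Q + height Q.
Definition nonempty (Q : rect) : Prop := left_ Q <= right_ Q /\ bot Q <= top Q.

Definition hull (P Q : rect) : rect :=
  Rect (Z.min (left_ P) (left_ Q)) (Z.max (right_ P) (right_ Q))
       (Z.min (bot P) (bot Q)) (Z.max (top P) (top Q)).

Definition xgap (P Q : rect) : Z :=
  Z.max 0 (Z.max (left_ Q - right_ P) (left_ P - right_ Q)).
Definition ygap (P Q : rect) : Z :=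
  Z.max 0 (Z.max (bot Q - top P) (bot P - top Q)).
Definition near (P Q : rect) : Prop := xgap P Q + ygap P Q <= 2.

Definition covers (S : region) (Q : rect) : Prop :=
  forall x y, inside Q x y -> S x y.

Ltac rlia := repeat match goal with Q : rect |- _ => destruct Q end;
  unfold near, xgap, ygap, nonempty, semiper, width, height, inside, hull in *;
  cbn [left_ right_ bot top] in *; lia.

Lemma evolve_confined (S : region) (Q : rect) t x y :
  (forall u v, S u v -> inside Q u v) -> evolve S t x y -> inside Q x y.
Proof.
move=> sub; elim: t x y => [|t IHt] x y /=; first exact: sub.
case=> [/IHt //|]; rewrite /two_neighbours.
have := IHt (x - 1) y; have := IHt (x + 1) y.
have := IHt x (y - 1); have := IHt x (y + 1).
rewrite /inside; case: Q {sub IHt} => a b c d /=.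
intuition lia.
Qed.

Lemma cross_fill (S : region) (Q : rect) x0 y0 x y :
  inside Q x0 y0 -> inside Q x y ->
  (forall u, left_ Q <= u <= right_ Q -> S u y0) ->
  (forall v, bot Q <= v <= top Q -> S x0 v) ->
  at_time S (Z.abs (x - x0) + Z.abs (y - y0)) x y.
Proof.
move=> in0 inxy row col.
have [m mE] : exists m, m = Z.to_nat (Z.abs (x - x0) + Z.abs (y - y0)) by eexists.
elim: m x y mE inxy => [|m IHm] x y mE inxy.
  by apply: at_time0; have -> : x = x0 by [lia]; apply: col; case: inxy.
have [->|nx] := Z.eq_dec x x0; first by apply: at_time0; apply: col; case: inxy.
have [->|ny] := Z.eq_dec y y0; first by apply: at_time0; apply: row; case: inxy.
apply: at_time_step; first lia.
right; right; split.
- have [lt|lt] : x < x0 \/ x0 < x by lia.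
    by right; apply: at_time_le (IHm (x + 1) y _ _); [lia | lia | rlia].
  by left; apply: at_time_le (IHm (x - 1) y _ _); [lia | lia | rlia].
- have [lt|lt] : y < y0 \/ y0 < y by lia.
    by right; apply: at_time_le (IHm x (y + 1) _ _); [lia | lia | rlia].
  by left; apply: at_time_le (IHm x (y - 1) _ _); [lia | lia | rlia].
Qed.

Lemma column_fill (S : region) (Q : rect) x0 c d x y :
  covers S Q -> nonempty Q -> left_ Q <= x0 <= right_ Q -> c <= bot Q -> top Q <= d ->
  (forall v, c <= v <= d -> S x0 v) ->
  left_ Q <= x <= right_ Q -> c <= y <= d ->
  at_time S (Z.abs (x - x0) + Z.max 0 (Z.max (y - top Q) (bot Q - y))) x y.
Proof.
move=> cov neQ hx0 hc hd col hx hy.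
pose y0 := Z.min (top Q) (Z.max (bot Q) y).
have /= := @cross_fill S (Rect (left_ Q) (right_ Q) c d) x0 y0 x y.
move=> H; apply: at_time_le (H _ _ _ _).
- rewrite /y0; rlia.
- rewrite /y0; rlia.
- rlia.
- by move=> u hu; apply: cov; rewrite /y0; rlia.
- by [].
Qed.

Lemma gap_fill (S : region) (P Q : rect) x0 y : covers S P -> covers S Q ->
  nonempty P -> nonempty Q -> ygap P Q <= 2 ->
  left_ P <= x0 <= right_ P -> left_ Q <= x0 <= right_ Q ->
  bot (hull P Q) <= y <= top (hull P Q) -> at_time S 1 x0 y.
Proof.
move=> cP cQ neP neQ gy hP hQ hy.
case: (classic (S x0 y)) => [|nS]; first exact: at_time0.
have nP : ~ inside P x0 y by move=> /cP.
have nQ : ~ inside Q x0 y by move=> /cQ.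
apply: at_time_step; first lia.
right; left.
case: (Z.le_gt_cases (bot P) y) => hb; split; apply: at_time0.
- by apply: cP; rlia.
- by apply: cQ; rlia.
- by apply: cQ; rlia.
- by apply: cP; rlia.
Qed.

Lemma overlap_fill (S : region) (P Q : rect) B : covers S P -> covers S Q ->
  nonempty P -> nonempty Q -> xgap P Q = 0 -> ygap P Q <= 2 ->
  width P + height (hull P Q) - height P <= B ->
  (width P < width (hull P Q) ->
     height (hull P Q) + width (hull P Q) - width P <= B) ->
  covers (at_time S B) (hull P Q).
Proof.
move=> cP cQ neP neQ gx gy B1 B2 x y inH.
have gap x0 y0 := @gap_fill S P Q x0 y0 cP cQ neP neQ gy.
have cov R : covers S R -> covers (at_time S 1) R.
  by move=> cR u v /cR; apply: at_time0.
have fill R x0 : covers S R -> nonempty R ->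
    left_ R <= x0 <= right_ R ->
    bot (hull P Q) <= bot R -> top R <= top (hull P Q) ->
    left_ P <= x0 <= right_ P -> left_ Q <= x0 <= right_ Q ->
    left_ R <= x <= right_ R ->
    1 + (Z.abs (x - x0) + Z.max 0 (Z.max (y - top R) (bot R - y))) <= B ->
    at_time S B x y.
  move=> cR neR h1 h2 h3 h4 h5 h6 le.
  apply: at_time_le le _; apply: at_time_add => //; first lia.
  apply: (@column_fill _ R x0 (bot (hull P Q)) (top (hull P Q))) => //.
  - exact: cov.
  - by move=> v hv; apply: gap.
  - by case: inH.
case: (Z.lt_ge_cases x (left_ P)) => xl.
  have hx : left_ Q < left_ P by clear -xl inH; rlia.
  apply: (fill Q (left_ P)) => //; clear fill gap cov cP cQ.
  - by clear -hx neP gx; rlia.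
  - by clear; rlia.
  - by clear; rlia.
  - by clear -neP; rlia.
  - by clear -hx neP gx; rlia.
  - by clear -hx xl inH neP gx; rlia.
  - have {}B2 : height (hull P Q) + width (hull P Q) - width P <= B.
      by apply: B2; clear -hx neP; rlia.
    by clear -B2 inH neQ xl; rlia.
case: (Z.lt_ge_cases (right_ P) x) => xr.
  have hx : right_ P < right_ Q by clear -xr inH; rlia.
  apply: (fill Q (right_ P)) => //; clear fill gap cov cP cQ.
  - by clear -hx neP gx; rlia.
  - by clear; rlia.
  - by clear; rlia.
  - by clear -neP; rlia.
  - by clear -hx neP gx; rlia.
  - by clear -hx xr inH neP gx; rlia.
  - have {}B2 : height (hull P Q) + width (hull P Q) - width P <= B.
      by apply: B2; clear -hx neP; rlia.
    by clear -B2 inH neQ xr; rlia.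
apply: (fill P (Z.max (left_ P) (left_ Q))) => //; clear fill gap cov cP cQ B2.
- by clear -neP gx neQ; rlia.
- by clear; rlia.
- by clear; rlia.
- by clear -neP gx neQ; rlia.
- by clear -neP gx neQ; rlia.
- have [h1 h2] : Z.abs (x - Z.max (left_ P) (left_ Q)) <= width P - 1 /\
      Z.max 0 (Z.max (y - top P) (bot P - y)) <= height (hull P Q) - height P.
    by split; [clear -neP neQ gx xl xr; rlia | clear -inH neP; rlia].
  by clear -h1 h2 B1; lia.
Qed.

Definition flip_rect (Q : rect) : rect := Rect (- right_ Q) (- left_ Q) (bot Q) (top Q).
Definition swap_rect (Q : rect) : rect := Rect (bot Q) (top Q) (left_ Q) (right_ Q).

Lemma covers_flip (S : region) (Q : rect) : covers S Q -> covers (flip S) (flip_rect Q).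
Proof. by move=> cQ x y inQ; apply: cQ; move: inQ; rewrite /flip_rect; rlia. Qed.

Lemma covers_swap (S : region) (Q : rect) : covers S Q -> covers (swap S) (swap_rect Q).
Proof. by move=> cQ x y inQ; apply: cQ; move: inQ; rewrite /swap_rect; rlia. Qed.

Lemma covers_unflip (S : region) T (Q : rect) :
  covers (at_time (flip S) T) (flip_rect Q) -> covers (at_time S T) Q.
Proof.
move=> cQ x y inQ; rewrite -(Z.opp_involutive x); apply/evolve_flip; apply: cQ.
by move: inQ; rewrite /flip_rect; rlia.
Qed.

Lemma covers_unswap (S : region) T (Q : rect) :
  covers (at_time (swap S) T) (swap_rect Q) -> covers (at_time S T) Q.
Proof.
move=> cQ x y inQ; apply/evolve_swap; apply: cQ.
by move: inQ; rewrite /swap_rect; rlia.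
Qed.

Lemma flip_hull (P Q : rect) : flip_rect (hull P Q) = hull (flip_rect P) (flip_rect Q).
Proof. by rewrite /flip_rect /hull /=; f_equal; lia. Qed.

Lemma corner_fill (S : region) (P Q : rect) B : covers S P -> covers S Q ->
  nonempty P -> nonempty Q -> left_ Q = right_ P + 1 -> bot Q = top P + 1 ->
  Z.max (width P) (height P) + 2 * semiper Q <= B ->
  covers (at_time S B) (hull P Q).
Proof.
move=> cP cQ neP neQ hx hy hB x y inH.
case: (classic (inside P x y)) => [inP|ninP]; first by apply/at_time0/cP.
have cov1 R : covers S R -> covers (at_time S 1) R.
  by move=> cR u v /cR; apply: at_time0.
pose p := right_ P; pose q := top P.
have corner1 : at_time S 1 (p + 1) q.
  apply: at_time_step => //; right; right; split.
    by left; apply: at_time0; apply: cP; rewrite /p /q; rlia.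
  by right; apply: at_time0; apply: cQ; rewrite /p /q; rlia.
have corner2 : at_time S 1 p (q + 1).
  apply: at_time_step => //; right; right; split.
    by right; apply: at_time0; apply: cQ; rewrite /p /q; rlia.
  by left; apply: at_time0; apply: cP; rewrite /p /q; rlia.
have row u : left_ P <= u <= right_ Q -> at_time S (semiper Q) u q.
  move=> hu; case: (Z.le_gt_cases u p) => up.
    by apply: at_time0; apply: cP; rewrite /p /q in up *; rlia.
  apply: (@at_time_le _ (1 + (Z.abs (u - (p + 1)) + Z.abs (q - (q + 1))))).
    by rewrite /p /q in up *; rlia.
  apply: at_time_add; [lia | lia |].
  apply: (@cross_fill _ (Rect (p + 1) (right_ Q) q (top Q))).
  - by rewrite /p /q; rlia.
  - by rewrite /p /q in up *; rlia.
  - by move=> w hw; apply: cov1 cQ _ _ _; rewrite /p /q in hw *; rlia.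
  move=> w hw; have [->//|nw] := Z.eq_dec w q.
  by apply: cov1 cQ _ _ _; rewrite /p /q in hw nw *; rlia.
have col v : bot P <= v <= top Q -> at_time S (semiper Q) p v.
  move=> hv; case: (Z.le_gt_cases v q) => vq.
    by apply: at_time0; apply: cP; rewrite /p /q in vq *; rlia.
  apply: (@at_time_le _ (1 + (Z.abs (p - (p + 1)) + Z.abs (v - (q + 1))))).
    by rewrite /p /q in vq *; rlia.
  apply: at_time_add; [lia | lia |].
  apply: (@cross_fill _ (Rect p (right_ Q) (q + 1) (top Q))).
  - by rewrite /p /q; rlia.
  - by rewrite /p /q in vq *; rlia.
  - move=> w hw; have [->//|nw] := Z.eq_dec w p.
    by apply: cov1 cQ _ _ _; rewrite /p /q in hw nw *; rlia.
  - by move=> w hw; apply: cov1 cQ _ _ _; rewrite /p /q in hw *; rlia.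
apply: (@at_time_le _ (semiper Q + (Z.abs (x - p) + Z.abs (y - q)))).
  by rewrite /p /q; clear row col; rlia.
apply: at_time_add; [rlia | lia |].
apply: (@cross_fill _ (hull P Q)) => //.
- by rewrite /p /q; clear row col; rlia.
- by move=> u hu; apply: row; rewrite /p /q in hu *; clear col; rlia.
- by move=> v hv; apply: col; rewrite /p /q in hv *; clear row; rlia.
Qed.

Lemma diagonal_fill (S : region) (P Q : rect) B : covers S P -> covers S Q ->
  nonempty P -> nonempty Q -> xgap P Q = 1 -> ygap P Q = 1 ->
  Z.max (width P) (height P) + 2 * (semiper (hull P Q) - semiper P) <= B ->
  covers (at_time S B) (hull P Q).
Proof.
have up S' P' Q' : covers S' P' -> covers S' Q' -> nonempty P' -> nonempty Q' ->
    xgap P' Q' = 1 -> bot Q' = top P' + 1 ->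
    Z.max (width P') (height P') + 2 * (semiper (hull P' Q') - semiper P') <= B ->
    covers (at_time S' B) (hull P' Q').
  move=> cP cQ neP neQ gx hy hB.
  have [hx|hx] : left_ Q' = right_ P' + 1 \/ left_ P' = right_ Q' + 1 by clear hB; rlia.
    by apply: corner_fill => //; rlia.
  apply: covers_unflip; rewrite flip_hull.
  apply: corner_fill; try (by apply: covers_flip); rewrite /flip_rect; rlia.
move=> cP cQ neP neQ gx gy hB.
have [hy|hy] : bot Q = top P + 1 \/ bot P = top Q + 1 by clear hB; rlia.
  exact: up.
apply: covers_unswap; apply: covers_unflip; apply: covers_unswap.
have -> : swap_rect (flip_rect (swap_rect (hull P Q))) =
   hull (swap_rect (flip_rect (swap_rect P))) (swap_rect (flip_rect (swap_rect Q))).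
  by rewrite /swap_rect /flip_rect /hull /=; f_equal; lia.
apply: up; try (by apply: covers_swap; apply: covers_flip; apply: covers_swap);
  rewrite /swap_rect /flip_rect; rlia.
Qed.

Lemma swap_hull (P Q : rect) : swap_rect (hull P Q) = hull (swap_rect P) (swap_rect Q).
Proof. by []. Qed.

Lemma near_fill_width (S : region) (P Q : rect) B : covers S P -> covers S Q ->
  nonempty P -> nonempty Q -> near P Q -> width P = width (hull P Q) ->
  width P + height (hull P Q) - height P <= B ->
  covers (at_time S B) (hull P Q).
Proof. by move=> cP cQ neP neQ nPQ wP hB; apply: overlap_fill => //; rlia. Qed.

Lemma near_fill_height (S : region) (P Q : rect) B : covers S P -> covers S Q ->
  nonempty P -> nonempty Q -> near P Q -> height P = height (hull P Q) ->
  height P + width (hull P Q) - width P <= B ->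
  covers (at_time S B) (hull P Q).
Proof.
move=> cP cQ neP neQ nPQ wP hB; apply: covers_unswap; rewrite swap_hull.
by apply: near_fill_width; try (by apply: covers_swap); rewrite /swap_rect; rlia.
Qed.

Lemma near_fill (S : region) (P Q : rect) B : covers S P -> covers S Q ->
  nonempty P -> nonempty Q -> near P Q ->
  Z.max (width (hull P Q)) (height (hull P Q)) + 2 * (semiper (hull P Q) - semiper P) <= B ->
  covers (at_time S B) (hull P Q).
Proof.
move=> cP cQ neP neQ nPQ hB.
have [gx|gx] := Z.eq_dec (xgap P Q) 0.
  by apply: overlap_fill => //; [clear hB; rlia | rlia | rlia].
have [gy|gy] := Z.eq_dec (ygap P Q) 0.
  apply: covers_unswap; rewrite swap_hull.
  apply: overlap_fill; try (by apply: covers_swap); rewrite /swap_rect;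
  [rlia|rlia|clear hB; rlia|clear hB; rlia|rlia|rlia].
by apply: diagonal_fill => //; [clear hB; rlia | clear hB; rlia | rlia].
Qed.

Definition within (A : region) (Q : rect) : region := fun x y => A x y /\ inside Q x y.

Definition spans_by (A : region) (Q : rect) (T : Z) : Prop :=
  covers (at_time (within A Q) T) Q.

Definition spanned (A : region) (Q : rect) : Prop := exists T, spans_by A Q T.

Definition subrect (P Q : rect) : Prop := forall x y, inside P x y -> inside Q x y.

Lemma spans_by_sub (A : region) (P Q : rect) T : subrect P Q ->
  spans_by A P T -> covers (at_time (within A Q) T) P.
Proof.
move=> sPQ sp x y /sp; apply: at_time_mono => u v [Auv Puv].
by split; last exact: sPQ.
Qed.

Lemma covers_at_time_add (S : region) (Q : rect) T T' : 0 <= T -> 0 <= T' ->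
  covers (at_time (at_time S T) T') Q -> covers (at_time S (T + T')) Q.
Proof. by move=> T0 T'0 cQ x y /cQ; apply: at_time_add. Qed.

Lemma covers_at_time_le (S : region) (Q : rect) T T' : T <= T' ->
  covers (at_time S T) Q -> covers (at_time S T') Q.
Proof. by move=> le cQ x y /cQ; apply: at_time_le. Qed.

Lemma spanned_merge (A : region) (P Q : rect) : nonempty P -> nonempty Q -> near P Q ->
  spanned A P -> spanned A Q -> spanned A (hull P Q).
Proof.
move=> neP neQ nPQ [T1 sP] [T2 sQ].
pose T := Z.max 0 (Z.max T1 T2).
eexists (T + Z.max 0 _); apply: covers_at_time_add; [lia | lia |].
apply: (@near_fill _ P Q) => //; last exact: Z.le_max_r.
- apply: (@covers_at_time_le _ _ T1); first lia.
  by apply: spans_by_sub sP => x y; clear; rlia.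
- apply: (@covers_at_time_le _ _ T2); first lia.
  by apply: spans_by_sub sQ => x y; clear; rlia.
Qed.

Lemma spanned_split (A : region) (Q : rect) : nonempty Q -> 3 <= semiper Q -> spanned A Q ->
  exists P1 P2, [/\ nonempty P1 /\ nonempty P2, spanned A P1 /\ spanned A P2,
    semiper P1 < semiper Q /\ semiper P2 < semiper Q, near P1 P2 & hull P1 P2 = Q].
Proof.
move=> neQ sQ [T spQ]; apply: NNPP => nosplit.
pose good P := [/\ nonempty P, spanned A P, semiper P < semiper Q & subrect P Q].
have merge P1 P2 : good P1 -> good P2 -> near P1 P2 -> good (hull P1 P2).
  move=> [ne1 sp1 s1 sub1] [ne2 sp2 s2 sub2] nr.
  have in1 := sub1 _ _ (conj (conj (Z.le_refl _) (proj1 ne1)) (conj (Z.le_refl _) (proj2 ne1))).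
  have in1' := sub1 _ _ (conj (conj (proj1 ne1) (Z.le_refl _)) (conj (proj2 ne1) (Z.le_refl _))).
  have in2 := sub2 _ _ (conj (conj (Z.le_refl _) (proj1 ne2)) (conj (Z.le_refl _) (proj2 ne2))).
  have in2' := sub2 _ _ (conj (conj (proj1 ne2) (Z.le_refl _)) (conj (proj2 ne2) (Z.le_refl _))).
  split; [by clear sub1 sub2; rlia | exact: spanned_merge | | by move=> x y; clear sub1 sub2; rlia].
  case: (Z.lt_ge_cases (semiper (hull P1 P2)) (semiper Q)) => // big.
  case: nosplit; exists P1, P2; split=> //.
  clear -ne1 ne2 s1 s2 in1 in1' in2 in2' big neQ sQ; destruct P1, P2, Q.
  rewrite /hull /semiper /width /height /inside /nonempty /= in
    ne1 ne2 s1 s2 in1 in1' in2 in2' big neQ sQ *.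
  by f_equal; lia.
have member t x y : evolve (within A Q) t x y -> exists2 P, good P & inside P x y.
  elim: t x y => [|t IHt] x y /=.
    move=> [Axy Qxy]; exists (Rect x x y y); last by rlia.
    split; [by rlia | | by rlia | by move=> u v; rlia].
    exists 0 => u v inP; apply: at_time0; split=> //.
    by have [-> ->] : u = x /\ v = y by rlia.
  case=> [/IHt //|H].
  have [u [v [u' [v' [e1 e2 d H']]]]] : exists u v u' v', [/\ evolve (within A Q) t u v,
     evolve (within A Q) t u' v', Z.abs (u - u') + Z.abs (v - v') <= 2 &
     Z.min u u' <= x <= Z.max u u' /\ Z.min v v' <= y <= Z.max v v'].
    by case: H => [[h1 h2]|[[h1 h2]|[[h1|h1] [h2|h2]]]];
      do 4 eexists; (split; [exact: h1 | exact: h2 | lia | lia]).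
  have [P1 g1 in1] := IHt _ _ e1; have [P2 g2 in2] := IHt _ _ e2.
  exists (hull P1 P2); first apply: merge => //; clear -in1 in2 d H'; rlia.
have grow P : good P -> exists2 P', good P' & semiper P < semiper P'.
  move=> gP; have [neP _ sP subP] := gP.
  have [x [y [inx ninx adj]]] : exists x y, [/\ inside Q x y, ~ inside P x y &
      near P (Rect x x y y)].
    have in1 := subP _ _ (conj (conj (Z.le_refl _) (proj1 neP)) (conj (Z.le_refl _) (proj2 neP))).
    have in2 := subP _ _ (conj (conj (proj1 neP) (Z.le_refl _)) (conj (proj2 neP) (Z.le_refl _))).
    clear -in1 in2 neP sP.
    have [h|[h|[h|h]]] : left_ Q < left_ P \/ right_ P < right_ Q \/ bot Q < bot P \/ top P < top Q.
      by rlia.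
    - by exists (left_ P - 1), (bot P); split; rlia.
    - by exists (right_ P + 1), (bot P); split; rlia.
    - by exists (left_ P), (bot P - 1); split; rlia.
    - by exists (left_ P), (top P + 1); split; rlia.
  have [P' gP' inP'] := member _ _ _ (spQ _ _ inx).
  exists (hull P P'); first by apply: merge => //; clear -inP' adj neP; rlia.
  by clear -inP' ninx neP; rlia.
have unbounded m : exists2 P, good P & Z.of_nat m <= semiper P.
  elim: m => [|m [P gP leP]].
    have inQ : inside Q (left_ Q) (bot Q) by clear -neQ; rlia.
    have [P gP _] := member _ _ _ (spQ _ _ inQ).
    by exists P => //; case: gP => ne _ _ _; clear -ne; rlia.
  by have [P' gP' lt] := grow P gP; exists P' => //; lia.
have [P [_ _ lt _] le] := unbounded (Z.to_nat (semiper Q)).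
by lia.
Qed.

Lemma spanned_right_column (A : region) (Q : rect) : nonempty Q -> spanned A Q ->
  exists2 y, bot Q <= y <= top Q & A (right_ Q) y.
Proof.
move=> neQ [T sp]; apply: NNPP => none.
have inQ : inside Q (right_ Q) (bot Q) by rlia.
pose P := Rect (left_ Q) (right_ Q - 1) (bot Q) (top Q).
have := @evolve_confined (within A Q) P _ _ _ _ (sp _ _ inQ); rewrite /P.
case=> [u v [Auv Quv]|]; last by simpl; lia.
have [uE|nu] := Z.eq_dec u (right_ Q); last by clear none sp; rlia.
by case: none; exists v; [rlia | rewrite -uE].
Qed.

(* [Gtime] is 18 F in the notation above. *)
Definition Gtime (k l : Z) : Z :=
  12 * k * l + Z.max k l * Z.max k l
  - Z.max 0 (Z.max k l - 3 * Z.min k l) * Z.max 0 (Z.max k l - 3 * Z.min k l).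

Lemma GtimeC k l : Gtime k l = Gtime l k.
Proof. by rewrite /Gtime (Z.max_comm k l) (Z.min_comm k l); lia. Qed.

Lemma Gtime_cases k l : 0 <= k -> 0 <= l ->
  [\/ (k <= l /\ l <= 3 * k) /\ Gtime k l = 12 * k * l + l * l,
      3 * k <= l /\ Gtime k l = 18 * k * l - 9 * k * k,
      (l <= k /\ k <= 3 * l) /\ Gtime k l = 12 * k * l + k * k |
      3 * l <= k /\ Gtime k l = 18 * k * l - 9 * l * l].
Proof.
move=> k0 l0; rewrite /Gtime.
have [[? ?]|[?|[[? ?]|?]]] : (k <= l /\ l <= 3 * k) \/ 3 * k <= l \/
    (l <= k /\ k <= 3 * l) \/ 3 * l <= k by lia.
- by constructor 1; rewrite (Z.max_r k l) ?(Z.min_l k l) ?Z.max_l; lia.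
- by constructor 2; rewrite (Z.max_r k l) ?(Z.min_l k l) ?Z.max_r; lia.
- by constructor 3; rewrite (Z.max_l k l) ?(Z.min_r k l) ?Z.max_l; lia.
- by constructor 4; rewrite (Z.max_l k l) ?(Z.min_r k l) ?Z.max_r; lia.
Qed.

Lemma Gtime_step_l k l : 1 <= k -> 1 <= l -> Gtime (k - 1) l + 12 * l <= Gtime k l.
Proof.
move=> k1 l1.
have := @Gtime_cases k l ltac:(lia) ltac:(lia).
have := @Gtime_cases (k - 1) l ltac:(lia) ltac:(lia).
by move=> [] [? ->] [] [? ->]; nia.
Qed.

Lemma Gtime_step_diag k l : 1 <= k -> 1 <= l ->
  Gtime (k - 1) (l - 1) + 18 * Z.max k l <= Gtime k l + 50.
Proof.
move=> k1 l1.
have := @Gtime_cases k l ltac:(lia) ltac:(lia).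
have := @Gtime_cases (k - 1) (l - 1) ltac:(lia) ltac:(lia).
by move=> [] [? ->] [] [? ->]; nia.
Qed.

Lemma Gtime_step_knight k l : 1 <= k -> 2 <= l ->
  Gtime (k - 1) (l - 2) + 18 * (k + l) <= Gtime k l + 100.
Proof.
move=> k1 l1.
have := @Gtime_cases k l ltac:(lia) ltac:(lia).
have := @Gtime_cases (k - 1) (l - 2) ltac:(lia) ltac:(lia).
by move=> [] [? ->] [] [? ->]; nia.
Qed.

Lemma Gtime_step_r k l : 1 <= k -> 1 <= l -> Gtime k (l - 1) + 12 * k <= Gtime k l.
Proof. by move=> k1 l1; rewrite !(GtimeC k); apply: Gtime_step_l. Qed.

Lemma Gtime_mono_l k' k l : 0 <= k' -> k' <= k -> 1 <= l -> Gtime k' l <= Gtime k l.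
Proof.
move=> k'0 le l1; have -> : k = k' + Z.of_nat (Z.to_nat (k - k')) by lia.
elim: (Z.to_nat _) => [|m IHm]; first by rewrite Z.add_0_r; lia.
have := @Gtime_step_l (k' + Z.of_nat m.+1) l ltac:(lia) l1.
by have -> : k' + Z.of_nat m.+1 - 1 = k' + Z.of_nat m by [lia]; lia.
Qed.

Lemma Gtime_mono k' k l' l : 1 <= k' -> k' <= k -> 1 <= l' -> l' <= l -> Gtime k' l' <= Gtime k l.
Proof.
move=> k1 lek l1 lel; apply: (@Z.le_trans _ (Gtime k l')); first by apply: Gtime_mono_l; lia.
by rewrite !(GtimeC k); apply: Gtime_mono_l; lia.
Qed.

Definition budget (Q : rect) : Z := Gtime (width Q) (height Q) + 500 * semiper Q.

Lemma column_finish (S : region) (Q : rect) c d : nonempty Q -> left_ Q < right_ Q ->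
  covers S (Rect (left_ Q) (right_ Q - 1) (bot Q) (top Q)) ->
  covers S (Rect (right_ Q) (right_ Q) c d) -> bot Q <= c -> c <= d -> d <= top Q ->
  covers (at_time S (height Q - (d - c))) Q.
Proof.
move=> neQ wQ cQ1 ccol hc hcd hd x y inQ.
have [xb|xb] := Z.eq_dec x (right_ Q); last by apply: at_time0; apply: cQ1; rlia.
pose y0 := Z.min d (Z.max c y).
have := @cross_fill S (Rect (right_ Q - 1) (right_ Q) (bot Q) (top Q)) (right_ Q - 1) y0 x y.
move=> cf; apply: at_time_le (cf _ _ _ _); rewrite ?/y0.
- by clear cf; rlia.
- by rlia.
- by rlia.
- move=> u hu; have [->|nu] := Z.eq_dec u (right_ Q); first by apply: ccol; clear cf; rlia.
  by apply: cQ1; clear cf; rlia.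
- by move=> v hv; apply: cQ1; clear cf; rlia.
Qed.

Lemma rect_eq (P Q : rect) : left_ P = left_ Q -> right_ P = right_ Q ->
  bot P = bot Q -> top P = top Q -> P = Q.
Proof. by case: P Q => [????] [????] /= -> -> -> ->. Qed.

(* The extra column is driven by [V] while [P1] and [P2] are still merging. *)
Lemma parallel_fill (S : region) (P1 P2 V Q : rect) B :
  nonempty P1 -> nonempty P2 -> nonempty V ->
  covers S P1 -> covers S P2 -> covers S V -> near P1 P2 -> near P1 V ->
  left_ Q < right_ Q ->
  hull P1 P2 = Rect (left_ Q) (right_ Q - 1) (bot Q) (top Q) ->
  right_ V = right_ Q -> left_ Q <= left_ V -> bot Q <= bot V -> top V <= top Q ->
  Z.max (width Q) (height Q) + 3 * (semiper Q - semiper P1) <= B ->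
  covers (at_time S B) Q.
Proof.
move=> ne1 ne2 neV c1 c2 cV n12 n1V wQ hQ rV lV bV tV hB.
have [eL eR eB eT] : [/\ Z.min (left_ P1) (left_ P2) = left_ Q,
   Z.max (right_ P1) (right_ P2) = right_ Q - 1,
   Z.min (bot P1) (bot P2) = bot Q & Z.max (top P1) (top P2) = top Q].
  by case: hQ.
pose T := Z.max (width Q) (height Q) + 2 * (semiper Q - semiper P1).
have -> : B = T + (B - T) by lia.
apply: covers_at_time_add.
- by rewrite /T; clear -ne1 ne2 neV eL eR eB eT wQ; rlia.
- by rewrite /T; clear -hB ne1 ne2 neV eL eR eB eT wQ; rlia.
apply: (@covers_at_time_le _ _ (height Q - (top P1 - bot P1))).
  by rewrite /T; clear -hB ne1 ne2 neV eL eR eB eT wQ; rlia.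
apply: column_finish => //.
- by clear -ne1 ne2 neV eL eR eB eT wQ; rlia.
- rewrite -hQ; apply: near_fill => //.
  by rewrite /T; clear -hB ne1 ne2 neV eL eR eB eT wQ; rlia.
- have cov : covers (at_time S T) (hull P1 V).
    apply: near_fill => //.
    by rewrite /T; clear -hB ne1 ne2 neV eL eR eB eT wQ rV lV bV tV; rlia.
  move=> x y inx; apply: cov.
  by clear -inx ne1 ne2 neV eL eR eB eT wQ rV lV bV tV; rlia.
- by clear -ne1 eB; rlia.
- by clear -ne1 eB; rlia.
- by clear -ne1 eT; rlia.
Qed.

(* In the bad step the rectangle grows by a single column, which costs [height Q] although the
   budget grows by two thirds of that only; the previous step pays for the rest. *)
Lemma extra_column_fill (S : region) (P1 P2 Q : rect) y :
  nonempty P1 -> nonempty P2 -> covers S P1 -> covers S P2 -> near P1 P2 ->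
  left_ Q < right_ Q ->
  hull P1 P2 = Rect (left_ Q) (right_ Q - 1) (bot Q) (top Q) ->
  semiper P1 < semiper Q - 1 ->
  bot Q <= y <= top Q -> S (right_ Q) y ->
  exists T, [/\ 0 <= T, 18 * T + budget P1 <= budget Q & covers (at_time S T) Q].
Proof.
move=> ne1 ne2 c1 c2 n12 wQ hQ sP hy Sy.
have [eL eR eB eT] : [/\ Z.min (left_ P1) (left_ P2) = left_ Q,
   Z.max (right_ P1) (right_ P2) = right_ Q - 1,
   Z.min (bot P1) (bot P2) = bot Q & Z.max (top P1) (top P2) = top Q].
  by case: hQ.
pose V := Rect (right_ Q) (right_ Q) y y.
have cV : covers S V.
  by move=> u v inV; have [-> ->] : u = right_ Q /\ v = y by clear -inV; rewrite /V in inV; rlia.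
pose k := width Q; pose l := height Q; pose k1 := width P1; pose l1 := height P1.
have dims : [/\ 1 <= k1, 1 <= l1, k1 <= k - 1 & l1 <= l].
  by rewrite /k /l /k1 /l1; clear -ne1 ne2 eL eR eB eT; split; rlia.
case: dims => k1p l1p k1k l1l.
have sum1 : k1 + l1 < k + l - 1 by rewrite /k /l /k1 /l1; clear -sP; rlia.
have budgetE T : 18 * T + Gtime k1 l1 <= Gtime k l + 500 * (k + l - k1 - l1) ->
    18 * T + budget P1 <= budget Q.
  by rewrite /budget /semiper -/k -/l -/k1 -/l1; lia.
have sequential T1 : 0 <= T1 -> covers (at_time S T1) (hull P1 P2) ->
    covers (at_time S (T1 + (l + 1))) Q.
  move=> T10 c12; apply: covers_at_time_add => //; first by rewrite /l; clear -hy; rlia.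
  have -> : Q = hull (hull P1 P2) V.
    by rewrite hQ; apply: rect_eq; clear -hy wQ; rewrite /V; rlia.
  apply: near_fill_height => //.
  - by move=> u v inV; apply/at_time0/cV.
  - by rewrite hQ; clear -wQ hy; rlia.
  - by rewrite /V; rlia.
  - by rewrite hQ /V; clear -wQ hy; rlia.
  - by rewrite hQ /V; clear -wQ hy; rlia.
  - by rewrite hQ /V /l; clear -wQ hy; rlia.
have parallel W : nonempty W -> covers S W -> near P1 W -> right_ W = right_ Q ->
    left_ Q <= left_ W -> bot Q <= bot W -> top W <= top Q ->
    covers (at_time S (Z.max k l + 3 * (semiper Q - semiper P1))) Q.
  by move=> *; apply: (@parallel_fill _ P1 P2 W); rewrite ?/k ?/l //; lia.
have parallel_time : k1 <= k - 1 -> l1 <= l - 1 ->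
    exists2 T, T = Z.max k l + 3 * (semiper Q - semiper P1) &
    0 <= T /\ 18 * T + budget P1 <= budget Q.
  move=> hk hl; eexists; first by []; split.
    by rewrite /semiper -/k -/l -/k1 -/l1; lia.
  apply: budgetE; rewrite /semiper -/k -/l -/k1 -/l1.
  have := @Gtime_step_diag k l ltac:(lia) ltac:(lia).
  by have := @Gtime_mono k1 (k - 1) l1 (l - 1) ltac:(lia) ltac:(lia) ltac:(lia) ltac:(lia); lia.
have [l1E|l1N] : l1 = l \/ l1 <= l - 1 by lia.
- have [k1E|k1N] : k1 = k - 2 \/ k1 <= k - 3 by lia.
  + have [rE|rE] : right_ P1 = right_ Q - 2 \/ right_ P1 = right_ Q - 1.
      by rewrite /k1 /k in k1E; clear -eL eR eB eT ne1 k1E; rlia.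
    * exists (l + 2); split; first lia.
        apply: budgetE; have := @Gtime_step_l k l ltac:(lia) ltac:(lia).
        have := @Gtime_step_l (k - 1) l ltac:(lia) ltac:(lia).
        by have -> : k - 1 - 1 = k1 by [lia]; rewrite l1E; lia.
      have -> : Q = hull P1 V.
        rewrite /k1 /k /l1 /l in k1E l1E.
        by apply: rect_eq; clear -eL eR eB eT ne1 ne2 k1E l1E hy wQ rE; rewrite /V; rlia.
      rewrite /k1 /k /l1 /l in k1E l1E *.
      by apply: near_fill_height => //; clear -eL eR eB eT ne1 ne2 k1E l1E hy wQ rE; rewrite /V; rlia.
    * exists (l + 2 + 1); split; first lia.
        apply: budgetE; have := @Gtime_step_l k l ltac:(lia) ltac:(lia).
        have := @Gtime_step_l (k - 1) l ltac:(lia) ltac:(lia).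
        by have -> : k - 1 - 1 = k1 by [lia]; rewrite l1E; lia.
      rewrite /k1 /k /l1 /l in k1E l1E *.
      apply: covers_at_time_add; [by clear -l1E ne1; rlia | by [] |].
      apply: (@covers_at_time_le _ _ (height Q - (top Q - bot Q))); first by rewrite /height; lia.
      apply: column_finish => //; try by clear -hy wQ; rlia.
      - by rewrite -hQ; apply: near_fill_height => //; rewrite hQ;
           clear -eL eR eB eT ne1 ne2 k1E l1E hy wQ rE; rlia.
      - have cov : covers (at_time S (height Q + 2)) (hull P1 V).
          by apply: near_fill_height => //; clear -eL eR eB eT ne1 ne2 k1E l1E hy wQ rE; rewrite /V; rlia.
        by move=> u v inuv; apply: cov; clear -inuv eL eR eB eT ne1 ne2 k1E l1E hy wQ rE; rewrite /V; rlia.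
  + exists (l + (k - k1) + (l + 1)); split; first lia.
      apply: budgetE; have := @Gtime_step_l k l ltac:(lia) ltac:(lia).
      have := @Gtime_step_l (k - 1) l ltac:(lia) ltac:(lia).
      have := @Gtime_step_l (k - 2) l ltac:(lia) ltac:(lia).
      have -> : k - 1 - 1 = k - 2 by lia.
      have -> : k - 2 - 1 = k - 3 by lia.
      by have := @Gtime_mono k1 (k - 3) l1 l ltac:(lia) ltac:(lia) ltac:(lia) ltac:(lia); lia.
    apply: sequential; first lia.
    apply: near_fill_height => //; rewrite hQ; rewrite /k1 /k /l1 /l in k1N l1E *;
      clear -eL eR eB eT ne1 ne2 k1N l1E hy wQ; rlia.
have [k1N|k1N] : k1 <= k - 3 \/ k - 2 <= k1 by lia.
  exists (Z.max k l + 2 * (k + l - k1 - l1) + (l + 1)); split; first lia.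
    apply: budgetE; have := @Gtime_step_diag k l ltac:(lia) ltac:(lia).
    have := @Gtime_step_l (k - 1) (l - 1) ltac:(lia) ltac:(lia).
    have := @Gtime_step_l (k - 2) (l - 1) ltac:(lia) ltac:(lia).
    have -> : k - 1 - 1 = k - 2 by lia.
    have -> : k - 2 - 1 = k - 3 by lia.
    by have := @Gtime_mono k1 (k - 3) l1 (l - 1) ltac:(lia) ltac:(lia) ltac:(lia) ltac:(lia); lia.
  apply: sequential; first lia.
  by apply: near_fill => //; rewrite hQ; rewrite /k1 /k /l1 /l in k1N l1N *;
      clear -eL eR eB eT ne1 ne2 k1N l1N hy wQ; rlia.
have [T TE [T0 TB]] := parallel_time k1k l1N.
have [yfar|ynear] : (y < bot P1 - 1 \/ top P1 + 1 < y) \/ bot P1 - 1 <= y <= top P1 + 1 by lia.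
- have l1N2 : l1 <= l - 2.
    by rewrite /l1 /l; clear -yfar ne1 hy eB eT; rlia.
  have [k1E|k1E] : k1 = k - 1 \/ k1 = k - 2 by lia.
  + exists (k + (l - l1) + (l + 1)); split; first lia.
      apply: budgetE; have := @Gtime_step_knight k l ltac:(lia) ltac:(lia).
      by have := @Gtime_mono k1 (k - 1) l1 (l - 2) ltac:(lia) ltac:(lia) ltac:(lia) ltac:(lia); lia.
    apply: sequential; first lia.
    by apply: near_fill_width => //; rewrite hQ; rewrite /k1 /k /l1 /l in k1E *;
      clear -eL eR eB eT ne1 ne2 k1E hy wQ; rlia.
  + exists (Z.max k l + 2 * (k + l - k1 - l1) + (l + 1)); split; first lia.
      apply: budgetE; have := @Gtime_step_diag k l ltac:(lia) ltac:(lia).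
      have := @Gtime_step_diag (k - 1) (l - 1) ltac:(lia) ltac:(lia).
      have -> : k - 1 - 1 = k - 2 by lia.
      have -> : l - 1 - 1 = l - 2 by lia.
      by have := @Gtime_mono k1 (k - 2) l1 (l - 2) ltac:(lia) ltac:(lia) ltac:(lia) ltac:(lia); lia.
    apply: sequential; first lia.
    by apply: near_fill => //; rewrite hQ; rewrite /k1 /k /l1 /l in k1E *;
      clear -eL eR eB eT ne1 ne2 k1E hy wQ; rlia.
have [nV|nnV] := classic (near P1 V).
  exists T; split=> //; rewrite TE; apply: (parallel V) => //;
    by clear -hy wQ; rewrite /V; rlia.
have [l1N2|l1E] : l1 <= l - 2 \/ l1 = l - 1 by lia.
  have k1E : k1 = k - 2.
    rewrite /k1 /k in k1N k1k *; clear -k1N k1k nnV ynear eL eR eB eT ne1 hy wQ.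
    by rewrite /V in nnV; rlia.
  exists (Z.max k l + 2 * (k + l - k1 - l1) + (l + 1)); split; first lia.
    apply: budgetE; have := @Gtime_step_diag k l ltac:(lia) ltac:(lia).
    have := @Gtime_step_diag (k - 1) (l - 1) ltac:(lia) ltac:(lia).
    have -> : k - 1 - 1 = k - 2 by lia.
    have -> : l - 1 - 1 = l - 2 by lia.
    by have := @Gtime_mono k1 (k - 2) l1 (l - 2) ltac:(lia) ltac:(lia) ltac:(lia) ltac:(lia); lia.
  apply: sequential; first lia.
  by apply: near_fill => //; rewrite hQ; rewrite /k1 /k /l1 /l in k1E *;
    clear -eL eR eB eT ne1 ne2 k1E hy wQ; rlia.
(* Here [P2] meets the corner of [hull P1 P2] next to the seed of the extra column. *)
have rE : right_ P1 = right_ Q - 2.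
  rewrite /k1 /k in k1N k1k; clear -k1N k1k nnV ynear eL eR eB eT ne1 hy wQ.
  by rewrite /V in nnV; rlia.
have yE : y = bot P1 - 1 \/ y = top P1 + 1.
  by clear -ne1 rE nnV ynear hy wQ; rewrite /V in nnV; rlia.
pose W := Rect (right_ Q - 1) (right_ Q) y y.
exists T; split=> //; rewrite TE; apply: (parallel W).
- by clear; rewrite /W; rlia.
- move=> u v inW; have [uE|nu] := Z.eq_dec u (right_ Q).
    by apply: cV; rewrite /W /V in inW *; clear -inW uE; rlia.
  apply: c2; rewrite /W /l1 /l in inW l1E; clear -inW nu rE yE eL eR eB eT ne1 ne2 l1E hy wQ; rlia.
- by rewrite /W; clear -rE yE ne1; rlia.
- by [].
- by rewrite /W; clear -wQ; rlia.
- by rewrite /W; clear -hy; rlia.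
- by rewrite /W; clear -hy; rlia.
Qed.

Definition spans_in_budget (A : region) (Q : rect) : Prop :=
  exists T, [/\ 0 <= T, 18 * T <= budget Q & spans_by A Q T].

Lemma spans_by_flip (A : region) (Q : rect) T :
  spans_by (flip A) (flip_rect Q) T <-> spans_by A Q T.
Proof.
split=> sp.
  apply: covers_unflip => x y /sp; apply: at_time_mono => u v [Auv Quv].
  by split=> //; rewrite /flip_rect in Quv; rlia.
move=> x y inQ; have /sp H : inside Q (- x) y by rewrite /flip_rect in inQ; rlia.
apply: at_time_mono (proj2 (evolve_flip _ _ _ _) H) => u v [Auv Quv].
by split=> //; rewrite /flip_rect; rlia.
Qed.

Lemma spans_by_swap (A : region) (Q : rect) T :
  spans_by (swap A) (swap_rect Q) T <-> spans_by A Q T.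
Proof.
split=> sp.
  apply: covers_unswap => x y /sp; apply: at_time_mono => u v [Auv Quv].
  by split=> //; rewrite /swap_rect in Quv; rlia.
move=> x y inQ; have /sp H : inside Q y x by rewrite /swap_rect in inQ; rlia.
apply: at_time_mono (proj2 (evolve_swap _ _ _ _) H) => u v [Auv Quv].
by split=> //; rewrite /swap_rect; rlia.
Qed.

Lemma spanned_flip (A : region) (Q : rect) : spanned A Q -> spanned (flip A) (flip_rect Q).
Proof. by move=> [T sp]; exists T; apply/spans_by_flip. Qed.

Lemma spanned_swap (A : region) (Q : rect) : spanned A Q -> spanned (swap A) (swap_rect Q).
Proof. by move=> [T sp]; exists T; apply/spans_by_swap. Qed.

Lemma spans_in_budget_flip (A : region) (Q : rect) :
  spans_in_budget (flip A) (flip_rect Q) -> spans_in_budget A Q.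
Proof.
move=> [T [T0 TB /spans_by_flip sp]]; exists T; split=> //.
by move: TB; rewrite /budget; congr (_ <= Gtime _ _ + 500 * _); rewrite /flip_rect; rlia.
Qed.

Lemma spans_in_budget_swap (A : region) (Q : rect) :
  spans_in_budget (swap A) (swap_rect Q) -> spans_in_budget A Q.
Proof.
move=> [T [T0 TB /spans_by_swap sp]]; exists T; split=> //.
move: TB; rewrite /budget GtimeC; congr (_ <= Gtime _ _ + 500 * _).
by rewrite /swap_rect; rlia.
Qed.

Lemma budget_ge0 (Q : rect) : nonempty Q -> 0 <= budget Q.
Proof.
move=> neQ; rewrite /budget.
have := @Gtime_mono 1 (width Q) 1 (height Q) ltac:(lia) ltac:(rlia) ltac:(lia) ltac:(rlia).
by have -> : Gtime 1 1 = 13 by []; rlia.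
Qed.

Lemma spans_in_budget_extra_column (A : region) (Q : rect) :
  let Q1 := Rect (left_ Q) (right_ Q - 1) (bot Q) (top Q) in
  (forall P, nonempty P -> semiper P < semiper Q -> spanned A P -> spans_in_budget A P) ->
  nonempty Q -> left_ Q < right_ Q -> spanned A Q -> spanned A Q1 -> spans_in_budget A Q.
Proof.
move=> Q1 IH neQ wQ sp sp1.
have neQ1 : nonempty Q1 by rewrite /Q1; clear -wQ neQ; rlia.
have [y hy Ay] := @spanned_right_column A Q neQ sp.
have [s2|s3] : semiper Q1 <= 2 \/ 3 <= semiper Q1 by lia.
  have [y1 hy1 Ay1] := @spanned_right_column A Q1 neQ1 sp1.
  exists 0; split; [by [] | by have := @budget_ge0 Q neQ; lia |].
  move=> u v inQ; apply: at_time0; split=> //.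
  rewrite /Q1 /= in s2 hy1 Ay1; clear -s2 hy1 Ay1 hy Ay inQ neQ wQ.
  have [uE|uE] : u = right_ Q \/ u = right_ Q - 1 by rlia.
    by rewrite uE; have -> : v = y by rlia.
  by rewrite uE; have -> : v = y1 by rlia.
have [P1 [P2 [[ne1 ne2] [spP1 spP2] [s1 s2] n12 hQ]]] := @spanned_split A Q1 neQ1 s3 sp1.
have sQ1 : semiper Q1 = semiper Q - 1 by rewrite /Q1; rlia.
have [T1 [T10 TB1 spT1]] := IH P1 ne1 ltac:(lia) spP1.
have [T2 [T20 TB2 spT2]] := IH P2 ne2 ltac:(lia) spP2.
wlog le : P1 P2 T1 T2 ne1 ne2 spP1 spP2 s1 s2 n12 hQ T10 TB1 spT1 T20 TB2 spT2 / T2 <= T1.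
  move=> W; case: (Z.le_ge_cases T2 T1) => le; first exact: (W P1 P2 T1 T2).
  apply: (W P2 P1 T2 T1) => //; first by clear -n12; rlia.
  by rewrite -hQ; apply: rect_eq => /=; lia.
have [eL eR eB eT] : [/\ Z.min (left_ P1) (left_ P2) = left_ Q,
   Z.max (right_ P1) (right_ P2) = right_ Q - 1,
   Z.min (bot P1) (bot P2) = bot Q & Z.max (top P1) (top P2) = top Q].
  by case: hQ.
have [T [T0 TB cT]] : exists T, [/\ 0 <= T, 18 * T + budget P1 <= budget Q &
    covers (at_time (at_time (within A Q) T1) T) Q].
  apply: (@extra_column_fill _ P1 P2 Q y) => //.
  - by apply: spans_by_sub spT1 => u v; clear -eL eR eB eT; rlia.
  - apply: covers_at_time_le le _.
    by apply: spans_by_sub spT2 => u v; clear -eL eR eB eT; rlia.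
  - by lia.
  - by apply: at_time0; split=> //; clear -hy wQ; rlia.
by exists (T1 + T); split; [lia | lia | apply: covers_at_time_add].
Qed.

Theorem spanned_in_budget (A : region) (Q : rect) :
  nonempty Q -> spanned A Q -> spans_in_budget A Q.
Proof.
have [m] : exists m, Z.of_nat m = Z.max 0 (semiper Q) by exists (Z.to_nat (semiper Q)); lia.
elim/ltn_ind: m A Q => m IHm A Q mE neQ sp.
have IH A' P : nonempty P -> semiper P < semiper Q -> spanned A' P -> spans_in_budget A' P.
  move=> neP lt; apply: (IHm (Z.to_nat (semiper P))) => //.
    by apply/ltP; clear -lt neP mE; rlia.
  by lia.
have [s2|s3] : semiper Q <= 2 \/ 3 <= semiper Q by lia.
  have [y hy Ay] := @spanned_right_column A Q neQ sp.
  exists 0; split; [by [] | by have := @budget_ge0 Q neQ; lia |].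
  move=> u v inQ; apply: at_time0; split=> //; clear IHm IH.
  have -> : u = right_ Q by rlia.
  by have -> : v = y by rlia.
have [P1 [P2 [[ne1 ne2] [spP1 spP2] [s1 s2] n12 hQ]]] := @spanned_split A Q neQ s3 sp.
have [T1 [T10 TB1 spT1]] := IH A P1 ne1 s1 spP1.
have [T2 [T20 TB2 spT2]] := IH A P2 ne2 s2 spP2.
wlog le : P1 P2 T1 T2 ne1 ne2 spP1 spP2 s1 s2 n12 hQ T10 TB1 spT1 T20 TB2 spT2 / T2 <= T1.
  move=> W; case: (Z.le_ge_cases T2 T1) => le; first exact: (W P1 P2 T1 T2).
  apply: (W P2 P1 T2 T1) => //; first by clear -n12; rlia.
  by rewrite -hQ; apply: rect_eq => /=; lia.
have [eL eR eB eT] : [/\ Z.min (left_ P1) (left_ P2) = left_ Q,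
   Z.max (right_ P1) (right_ P2) = right_ Q,
   Z.min (bot P1) (bot P2) = bot Q & Z.max (top P1) (top P2) = top Q].
  by rewrite -hQ.
have [sbad|sgood] : semiper P1 = semiper Q - 1 \/ semiper P1 <= semiper Q - 2 by lia.
  have [PE|[PE|[PE|PE]]] : P1 = Rect (left_ Q) (right_ Q - 1) (bot Q) (top Q) \/
     P1 = Rect (left_ Q + 1) (right_ Q) (bot Q) (top Q) \/
     P1 = Rect (left_ Q) (right_ Q) (bot Q) (top Q - 1) \/
     P1 = Rect (left_ Q) (right_ Q) (bot Q + 1) (top Q).
    clear -eL eR eB eT sbad; have [h|[h|[h|h]]] : right_ P1 = right_ Q - 1 \/
      left_ P1 = left_ Q + 1 \/ top P1 = top Q - 1 \/ bot P1 = bot Q + 1 by rlia.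
    - by left; apply: rect_eq; rlia.
    - by right; left; apply: rect_eq; rlia.
    - by right; right; left; apply: rect_eq; rlia.
    - by right; right; right; apply: rect_eq; rlia.
  - apply: spans_in_budget_extra_column => //; last by rewrite -PE.
    + by move=> P; apply: IH.
    + by clear -PE ne1; rewrite PE in ne1; rlia.
  - apply: spans_in_budget_flip; apply: spans_in_budget_extra_column.
    + by move=> P neP lt; apply: IH => //; clear -lt; rewrite /flip_rect in lt; rlia.
    + by clear -neQ; rewrite /flip_rect; rlia.
    + by clear -PE ne1; rewrite PE in ne1; rewrite /flip_rect; rlia.
    + exact: spanned_flip.
    + move/spanned_flip: spP1; rewrite PE; congr spanned.
      by apply: rect_eq => /=; lia.
  - apply: spans_in_budget_swap; apply: spans_in_budget_extra_column.
    + by move=> P neP lt; apply: IH => //; clear -lt; rewrite /swap_rect in lt; rlia.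
    + by clear -neQ; rewrite /swap_rect; rlia.
    + by clear -PE ne1; rewrite PE in ne1; rewrite /swap_rect; rlia.
    + exact: spanned_swap.
    + by move/spanned_swap: spP1; rewrite PE.
  - apply: spans_in_budget_swap; apply: spans_in_budget_flip.
    apply: spans_in_budget_extra_column.
    + by move=> P neP lt; apply: IH => //; clear -lt; rewrite /flip_rect /swap_rect in lt; rlia.
    + by clear -neQ; rewrite /flip_rect /swap_rect; rlia.
    + by clear -PE ne1; rewrite PE in ne1; rewrite /flip_rect /swap_rect; rlia.
    + by apply: spanned_flip; apply: spanned_swap.
    + move/spanned_swap/spanned_flip: spP1; rewrite PE; congr spanned.
      by apply: rect_eq => /=; lia.
have cP1 : covers (at_time (within A Q) T1) P1.
  by apply: spans_by_sub spT1 => u v; clear -eL eR eB eT; rlia.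
have cP2 : covers (at_time (within A Q) T1) P2.
  apply: covers_at_time_le le _.
  by apply: spans_by_sub spT2 => u v; clear -eL eR eB eT; rlia.
suff [T [T0 TB cT]] : exists T, [/\ 0 <= T, 18 * T + budget P1 <= budget Q &
    covers (at_time (at_time (within A Q) T1) T) (hull P1 P2)].
  by exists (T1 + T); split; [lia | lia | apply: covers_at_time_add => //; rewrite -{2}hQ].
pose k := width Q; pose l := height Q; pose k1 := width P1; pose l1 := height P1.
have dims : [/\ 1 <= k1, 1 <= l1, k1 <= k & l1 <= l].
  by rewrite /k /l /k1 /l1; clear -ne1 ne2 eL eR eB eT; split; rlia.
case: dims => k1p l1p k1k l1l.
have sum1 : k1 + l1 <= k + l - 2 by rewrite /k /l /k1 /l1; clear -sgood; rlia.
have budgetE T : 18 * T + Gtime k1 l1 <= Gtime k l + 500 * (k + l - k1 - l1) ->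
    18 * T + budget P1 <= budget Q.
  by rewrite /budget /semiper -/k -/l -/k1 -/l1; lia.
have [l1E|l1N] : l1 = l \/ l1 <= l - 1 by lia.
  exists (l + (k - k1)); split; first lia.
    apply: budgetE; have := @Gtime_step_l k l ltac:(lia) ltac:(lia).
    have := @Gtime_step_l (k - 1) l ltac:(lia) ltac:(lia).
    have -> : k - 1 - 1 = k - 2 by lia.
    by have := @Gtime_mono k1 (k - 2) l1 l ltac:(lia) ltac:(lia) ltac:(lia) ltac:(lia); lia.
  by apply: near_fill_height => //; rewrite hQ -/l1 -/l -/k1 -/k; lia.
have [k1E|k1N] : k1 = k \/ k1 <= k - 1 by lia.
  exists (k + (l - l1)); split; first lia.
    apply: budgetE; have := @Gtime_step_r k l ltac:(lia) ltac:(lia).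
    have := @Gtime_step_r k (l - 1) ltac:(lia) ltac:(lia).
    have -> : l - 1 - 1 = l - 2 by lia.
    by have := @Gtime_mono k1 k l1 (l - 2) ltac:(lia) ltac:(lia) ltac:(lia) ltac:(lia); lia.
  by apply: near_fill_width => //; rewrite hQ -/l1 -/l -/k1 -/k; lia.
exists (Z.max k l + 2 * (k + l - k1 - l1)); split; first lia.
  apply: budgetE; have := @Gtime_step_diag k l ltac:(lia) ltac:(lia).
  by have := @Gtime_mono k1 (k - 1) l1 (l - 1) ltac:(lia) ltac:(lia) ltac:(lia) ltac:(lia); lia.
by apply: near_fill => //; rewrite hQ /semiper -/l1 -/l -/k1 -/k; lia.
Qed.

(* If [tau] never exceeds one plus the second smallest value among the neighbours, it bounds the
   infection times from below. *)
Lemma infection_time_ge (S : region) (Q : rect) (tau : Z -> Z -> Z) t x y :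
  (forall u v, S u v -> inside Q u v /\ tau u v <= 0) ->
  (forall T u v, 0 <= T -> inside Q u v ->
     two_neighbours (fun u' v' => inside Q u' v' /\ tau u' v' <= T) u v -> tau u v <= T + 1) ->
  evolve S t x y -> tau x y <= Z.of_nat t.
Proof.
move=> seed0 slow.
have conf s u v : evolve S s u v -> inside Q u v.
  by apply: evolve_confined => u' v' /seed0 [].
elim: t x y => [|t IHt] x y /=; first by case/seed0.
case=> [/IHt|H]; first lia.
have -> : Z.pos (Pos.of_succ_nat t) = Z.of_nat t + 1 by lia.
apply: slow; [lia | by apply: (conf t.+1); right |].
by apply: two_neighbours_mono H => u v H; split; [apply: conf H | apply: IHt].
Qed.

(* The slow set lives in columns 0, ..., n - 1 and rows - e, ..., 3 q + e with n = 3 q + 1 + 2 e.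
   Column 0 starts with an infected segment of length 3 q + 1; each of the next 2 e columns brings
   one more row, alternately at the top and at the bottom, and is filled from the seed at its new
   corner; the remaining 3 q columns come in groups of three, two filled downwards
   simultaneously and one upwards. *)
Definition slow_grid (q e : Z) : rect := Rect 0 (3 * q + 2 * e) (- e) (3 * q + e).

Definition slow_seed (q e : Z) : region := fun x y =>
  (x = 0 /\ 0 <= y <= 3 * q) \/
  (exists2 i, 0 <= i < e & x = 2 * i + 1 /\ y = 3 * q + 1 + i) \/
  (exists2 i, 1 <= i <= e & x = 2 * i /\ y = - i) \/
  (exists2 i, 0 <= i < q & x = 2 * e + 2 + 3 * i /\ y = 3 * q + e) \/
  (exists2 i, 0 <= i < q & x = 2 * e + 3 + 3 * i /\ y = - e).

Definition odd_start (q i : Z) : Z := 2 * (3 * q + 1) * i + i * (2 * i - 1).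
Definition even_start (q i : Z) : Z := odd_start q (i - 1) + (3 * q + 1) + 2 * (i - 1).
Definition group_start (q e i : Z) : Z := odd_start q e + i * (6 * q + 4 * e + 1).

Lemma odd_start_next q i : odd_start q i = even_start q i + 3 * q + 2 * i.
Proof. by rewrite /even_start /odd_start; lia. Qed.

Lemma even_start_next q i : even_start q (i + 1) = odd_start q i + 3 * q + 1 + 2 * i.
Proof. by rewrite /even_start /odd_start; lia. Qed.

Lemma group_start0 q e : group_start q e 0 = odd_start q e.
Proof. by rewrite /group_start; lia. Qed.

Lemma group_start_next q e i :
  group_start q e (i + 1) = group_start q e i + 6 * q + 4 * e + 1.
Proof. by rewrite /group_start; lia. Qed.

Definition slow_time (q e x y : Z) : Z :=
  if (3 * q + 1 <=? y) && (x <=? 2 * (y - (3 * q + 1))) then odd_start q (y - (3 * q + 1)) + 1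
  else if (3 * q + 1 <=? y) && (x =? 2 * (y - (3 * q + 1)) + 1) then 0
  else if (y <? 0) && (x <? - (2 * y)) then even_start q (- y) + 1
  else if (y <? 0) && (x =? - (2 * y)) then 0
  else if x =? 0 then 0
  else if x <=? 2 * e then
    if Z.odd x then odd_start q (x / 2) + (3 * q + 1 + x / 2 - y)
    else even_start q (x / 2) + (y + x / 2)
  else
    let b := group_start q e ((x - 2 * e - 1) / 3) in
    let r := (x - 2 * e - 1) mod 3 in
    if r =? 0 then b + 3 * q + 1 + e - y
    else if r =? 1 then if y =? 3 * q + e then 0 else b + 3 * q + 2 + e - y
    else if y =? - e then 0 else b + 3 * q + 1 + 3 * e + y.

Ltac zif := repeat match goal with
  | |- context [?a <=? ?b] => case: (Z.leb_spec a b) => ?; cbn [andb]; try lia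
  | |- context [?a <? ?b] => case: (Z.ltb_spec a b) => ?; cbn [andb]; try lia
  | |- context [?a =? ?b] => case: (Z.eqb_spec a b) => ?; cbn [andb]; try lia
  end.

Lemma half_odd i : (2 * i + 1) / 2 = i.
Proof. by Z.to_euclidean_division_equations; lia. Qed.

Lemma half_even i : (2 * i) / 2 = i.
Proof. by Z.to_euclidean_division_equations; lia. Qed.

Lemma group_div_mod e i r : 0 <= r < 3 -> (2 * e + 1 + 3 * i + r - 2 * e - 1) / 3 = i /\
  (2 * e + 1 + 3 * i + r - 2 * e - 1) mod 3 = r.
Proof. by move=> ?; split; Z.to_euclidean_division_equations; lia. Qed.

Lemma slow_time_top q e x y i : 0 <= i -> x <= 2 * i -> y = 3 * q + 1 + i ->
  slow_time q e x y = odd_start q i + 1.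
Proof.
move=> hi hx ->; rewrite /slow_time; zif.
by have -> : 3 * q + 1 + i - (3 * q + 1) = i by lia.
Qed.

Lemma slow_time_bottom q e x y i : 0 <= q -> 1 <= i -> x < 2 * i -> y = - i ->
  slow_time q e x y = even_start q i + 1.
Proof.
by move=> hq hi hx ->; rewrite /slow_time; zif; rewrite Z.opp_involutive.
Qed.

Lemma slow_time_odd q e x y i : 0 <= q -> 0 <= i < e -> x = 2 * i + 1 ->
  - i <= y <= 3 * q + i -> slow_time q e x y = odd_start q i + (3 * q + 1 + i - y).
Proof.
move=> hq hi -> hy; rewrite /slow_time; zif.
all: by rewrite half_odd Z.odd_add Z.odd_mul.
Qed.

Lemma slow_time_even q e x y i : 0 <= q -> 1 <= i <= e -> x = 2 * i ->
  - i < y <= 3 * q + i -> slow_time q e x y = even_start q i + (y + i).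
Proof.
move=> hq hi -> hy; rewrite /slow_time; zif.
all: by rewrite half_even Z.odd_mul.
Qed.

Lemma slow_time_group1 q e x y i : 0 <= q -> 0 <= e -> 0 <= i -> x = 2 * e + 1 + 3 * i ->
  - e <= y <= 3 * q + e -> slow_time q e x y = group_start q e i + 3 * q + 1 + e - y.
Proof.
move=> hq he hi -> hy; rewrite /slow_time.
have [] := @group_div_mod e i 0 ltac:(lia); rewrite Z.add_0_r => -> ->; zif.
Qed.

Lemma slow_time_group2 q e x y i : 0 <= q -> 0 <= e -> 0 <= i -> x = 2 * e + 2 + 3 * i ->
  - e <= y < 3 * q + e -> slow_time q e x y = group_start q e i + 3 * q + 2 + e - y.
Proof.
move=> hq he hi hx hy; have -> : x = 2 * e + 1 + 3 * i + 1 by lia.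
rewrite /slow_time.
by have [-> ->] := @group_div_mod e i 1 ltac:(lia); zif.
Qed.

Lemma slow_time_group3 q e x y i : 0 <= q -> 0 <= e -> 0 <= i -> x = 2 * e + 3 + 3 * i ->
  - e < y <= 3 * q + e -> slow_time q e x y = group_start q e i + 3 * q + 1 + 3 * e + y.
Proof.
move=> hq he hi hx hy; have -> : x = 2 * e + 1 + 3 * i + 2 by lia.
rewrite /slow_time.
by have [-> ->] := @group_div_mod e i 2 ltac:(lia); zif.
Qed.

Lemma slow_seed_time q e x y : 0 <= q -> 0 <= e -> slow_seed q e x y ->
  inside (slow_grid q e) x y /\ slow_time q e x y <= 0.
Proof.
move=> hq he [[-> hy]|[[i hi [-> ->]]|[[i hi [-> ->]]|[[i hi [-> ->]]|[i hi [-> ->]]]]]].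
- by split; [rewrite /slow_grid; rlia | rewrite /slow_time; zif].
- by split; [rewrite /slow_grid; rlia | rewrite /slow_time; zif].
- by split; [rewrite /slow_grid; rlia | rewrite /slow_time; zif].
- split; first by rewrite /slow_grid; rlia.
  have -> : 2 * e + 2 + 3 * i = 2 * e + 1 + 3 * i + 1 by lia.
  by rewrite /slow_time; have [-> ->] := @group_div_mod e i 1 ltac:(lia); zif.
- split; first by rewrite /slow_grid; rlia.
  have -> : 2 * e + 3 + 3 * i = 2 * e + 1 + 3 * i + 2 by lia.
  by rewrite /slow_time; have [-> ->] := @group_div_mod e i 2 ltac:(lia); zif.
Qed.

Lemma slow_time_cases q e x y : 0 <= q -> 1 <= e -> inside (slow_grid q e) x y ->
  slow_time q e x y <= 0 \/ exists i,
  [\/ 0 <= i < e /\ x <= 2 * i /\ y = 3 * q + 1 + i,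
      1 <= i <= e /\ x < 2 * i /\ y = - i,
      0 <= i < e /\ x = 2 * i + 1 /\ - i <= y <= 3 * q + i |
      1 <= i <= e /\ x = 2 * i /\ - i < y <= 3 * q + i] \/
  [\/ 0 <= i < q /\ x = 2 * e + 1 + 3 * i,
      0 <= i < q /\ x = 2 * e + 2 + 3 * i /\ y < 3 * q + e |
      0 <= i < q /\ x = 2 * e + 3 + 3 * i /\ - e < y].
Proof.
move=> hq he; rewrite /inside /slow_grid; cbn [left_ right_ bot top] => -[hx hy].
case: (classic (3 * q + 1 <= y /\ x <= 2 * (y - (3 * q + 1)) + 1)) => [[h1 h2]|ntop].
  have [hx'|hx'] : x <= 2 * (y - (3 * q + 1)) \/ x = 2 * (y - (3 * q + 1)) + 1 by lia.
    by right; exists (y - (3 * q + 1)); left; constructor 1; lia.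
  by left; rewrite /slow_time; zif.
case: (classic (y < 0 /\ x <= - (2 * y))) => [[h1 h2]|nbot].
  have [hx'|hx'] : x < - (2 * y) \/ x = - (2 * y) by lia.
    by right; exists (- y); left; constructor 2; lia.
  by left; rewrite /slow_time; zif.
have [x0|[xe|xg]] : x = 0 \/ 1 <= x <= 2 * e \/ 2 * e + 1 <= x by lia.
- by left; rewrite /slow_time; zif.
- right; exists (x / 2); left.
  have [i xE] : exists i, x = 2 * i \/ x = 2 * i + 1.
    by exists (x / 2); Z.to_euclidean_division_equations; lia.
  case: xE => xE; rewrite xE ?half_odd ?half_even.
    by constructor 4; lia.
  by constructor 3; lia.
have [i xE] : exists i, x = 2 * e + 1 + 3 * i \/ x = 2 * e + 2 + 3 * i \/ x = 2 * e + 3 + 3 * i.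
  by exists ((x - 2 * e - 1) / 3); Z.to_euclidean_division_equations; lia.
case: xE => [xE|[xE|xE]].
- by right; exists i; right; constructor 1; lia.
- have [yE|yN] := Z.eq_dec y (3 * q + e).
    left; apply: (proj2 (@slow_seed_time q e x y _ _ _)); [lia | lia |].
    by right; right; right; left; exists i; lia.
  by right; exists i; right; constructor 2; lia.
- have [yE|yN] := Z.eq_dec y (- e).
    left; apply: (proj2 (@slow_seed_time q e x y _ _ _)); [lia | lia |].
    by right; right; right; right; exists i; lia.
  by right; exists i; right; constructor 3; lia.
Qed.

Lemma three_of_four (P : region) x y :
  two_neighbours P x y ->
  [/\ P (x + 1) y \/ P x (y - 1) \/ P x (y + 1), P (x - 1) y \/ P x (y - 1) \/ P x (y + 1),
     P (x - 1) y \/ P (x + 1) y \/ P x (y + 1) & P (x - 1) y \/ P (x + 1) y \/ P x (y - 1)].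
Proof. by rewrite /two_neighbours => H; split; tauto. Qed.

Ltac time_at le j := first
  [ rewrite (@slow_time_top _ _ _ _ j) in le; [lia | lia ..]
  | rewrite (@slow_time_bottom _ _ _ _ j) in le; [lia | lia ..]
  | rewrite (@slow_time_odd _ _ _ _ j) in le; [lia | lia ..]
  | rewrite (@slow_time_even _ _ _ _ j) in le; [lia | lia ..]
  | rewrite (@slow_time_group1 _ _ _ _ j) in le; [lia | lia ..]
  | rewrite (@slow_time_group2 _ _ _ _ j) in le; [lia | lia ..]
  | rewrite (@slow_time_group3 _ _ _ _ j) in le; [lia | lia ..] ].

Ltac neighbours H i :=
  case: H => [[? ?]|[[? ?]|[? ?]]];
  match goal with le : slow_time _ _ _ _ <= _ |- _ => first
    [ exfalso; lia | time_at le i | time_at le (i + 1) | time_at le (i - 1) | time_at le 0 ]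
  end.

(* A site may have one neighbour that is infected much earlier; [nleft], [nright], [ndown] and [nup]
   say that one of the three other neighbours is infected at time [T]. *)
Lemma slow_time_local q e T x y : 1 <= q -> 1 <= e -> 0 <= T -> inside (slow_grid q e) x y ->
  two_neighbours (fun u v => inside (slow_grid q e) u v /\ slow_time q e u v <= T) x y ->
  slow_time q e x y <= T + 1.
Proof.
move=> hq he T0 inxy; have := @slow_time_cases q e x y ltac:(lia) he inxy.
move: inxy; rewrite /inside /slow_grid; cbn [left_ right_ bot top] => inxy.
case=> [le|[i cases]] /three_of_four; first by lia.
have E := odd_start_next q i; have E' := even_start_next q i.
have E1 := odd_start_next q (i + 1); have E1' := even_start_next q (i - 1).
have E2 := odd_start_next q (i - 1).
have F := group_start_next q e i; have F' := group_start_next q e (i - 1).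
have F0 := group_start0 q e.
rewrite (_ : i - 1 + 1 = i) in E1' F'; last by lia.
rewrite /inside /slow_grid; cbv beta; cbn [left_ right_ bot top].
move=> [nleft nright ndown nup].
case: cases => [[|||]|[||]].
- move=> [hi [hx yE]]; rewrite (@slow_time_top q e x y i); try lia.
  have [xE|xN] := Z.eq_dec x (2 * i); last first.
    neighbours ndown i.
  have [i0|iN] := Z.eq_dec i 0.
    by move: T0; rewrite i0 /odd_start; lia.
  neighbours nright i.
- move=> [hi [hx yE]]; rewrite (@slow_time_bottom q e x y i); try lia.
  have [xE|xN] := Z.eq_dec x (2 * i - 1); last first.
    neighbours nup i.
  neighbours nright i.
- move=> [hi [xE hy]]; rewrite (@slow_time_odd q e x y i); try lia.
  have [yb|yb] := Z.eq_dec y (- i).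
    neighbours nleft i.
  have [yE|yN] := Z.eq_dec y (3 * q + i); last first.
    neighbours nleft i.
  have [i0|iN] := Z.eq_dec i 0.
    by move: T0; rewrite yE i0 /odd_start; lia.
  neighbours nup i.
- move=> [hi [xE hy]]; rewrite (@slow_time_even q e x y i); try lia.
  have [ie|ie] := Z.eq_dec i e.
    have F0' : group_start q e 0 = odd_start q i by rewrite ie.
    have [yE|yN] := Z.eq_dec y (- i + 1); [neighbours ndown i | neighbours nleft i].
  have [yt|yt] := Z.eq_dec y (3 * q + i); first neighbours nleft i.
  by have [yE|yN] := Z.eq_dec y (- i + 1); [neighbours ndown i | neighbours nleft i].
- move=> [hi xE]; rewrite (@slow_time_group1 q e x y i); try lia.
  have [yE|yN] := Z.eq_dec y (3 * q + e); last first.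
    neighbours nleft i.
  have [i0|iN] := Z.eq_dec i 0.
    rewrite i0 in xE F0 *.
    have Ee := odd_start_next q e.
    neighbours nright e.
  neighbours nright i.
- move=> [hi [xE hy]]; rewrite (@slow_time_group2 q e x y i); try lia.
  have [yE|yN] := Z.eq_dec y (- e).
    neighbours nright i.
  neighbours nup i.
- move=> [hi [xE hy]]; rewrite (@slow_time_group3 q e x y i); try lia.
  have [yE|yN] := Z.eq_dec y (- e + 1).
    neighbours ndown i.
  neighbours nleft i.
Qed.

Lemma spanned_site (A : region) x y : A x y -> spanned A (Rect x x y y).
Proof.
move=> Axy; exists 0 => u v inP; apply: at_time0; split=> //.
by have [-> ->] : u = x /\ v = y by clear -inP; rlia.
Qed.

Lemma spanned_add_site (A : region) (P Q : rect) x y : nonempty P -> spanned A P -> A x y ->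
  near P (Rect x x y y) -> hull P (Rect x x y y) = Q -> spanned A Q.
Proof.
move=> neP sP Axy nP <-; apply: spanned_merge => //; last exact: spanned_site.
by rlia.
Qed.

Lemma slow_spanned q e : 0 <= q -> 0 <= e -> spanned (slow_seed q e) (slow_grid q e).
Proof.
move=> hq he.
have corners (m : nat) : Z.of_nat m <= e ->
    spanned (slow_seed q e) (Rect 0 (2 * Z.of_nat m) (- Z.of_nat m) (3 * q + Z.of_nat m)).
  elim: m => [|m IHm] hm.
    exists 0 => x y inP; apply: at_time0; split=> //.
    by left; clear -inP; rlia.
  set i := Z.of_nat m in IHm; have iE : Z.of_nat m.+1 = i + 1 by rewrite /i; lia.
  rewrite iE in hm *; have i0 : 0 <= i by rewrite /i; lia.
  have {IHm} sp := IHm ltac:(lia).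
  apply: (@spanned_add_site _ (Rect 0 (2 * i + 1) (- i) (3 * q + 1 + i)) _ (2 * i + 2) (- i - 1)).
  - by clear -hq i0; rlia.
  - apply: (@spanned_add_site _ _ _ (2 * i + 1) (3 * q + 1 + i)) sp _ _ _.
    + by clear -hq i0; rlia.
    + by right; left; exists i; lia.
    + by clear -hq i0; rlia.
    + by apply: rect_eq; rewrite /hull; cbn [left_ right_ bot top]; lia.
  - by right; right; left; exists (i + 1); lia.
  - by clear -hq i0; rlia.
  - by apply: rect_eq; rewrite /hull; cbn [left_ right_ bot top]; lia.
have groups (m : nat) : Z.of_nat m <= q ->
    spanned (slow_seed q e) (Rect 0 (2 * e + 3 * Z.of_nat m) (- e) (3 * q + e)).
  elim: m => [|m IHm] hm.
    have := corners (Z.to_nat e); rewrite Z2Nat.id // => /(_ (Z.le_refl _)).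
    by rewrite Z.mul_0_r Z.add_0_r.
  set i := Z.of_nat m in IHm; have iE : Z.of_nat m.+1 = i + 1 by rewrite /i; lia.
  rewrite iE in hm *; have i0 : 0 <= i by rewrite /i; lia.
  have {IHm} sp := IHm ltac:(lia).
  apply: (@spanned_add_site _ (Rect 0 (2 * e + 2 + 3 * i) (- e) (3 * q + e)) _
    (2 * e + 3 + 3 * i) (- e)).
  - by clear -hq he i0; rlia.
  - apply: (@spanned_add_site _ _ _ (2 * e + 2 + 3 * i) (3 * q + e)) sp _ _ _.
    + by clear -hq he i0; rlia.
    + by right; right; right; left; exists i; lia.
    + by clear -hq he i0; rlia.
    + by apply: rect_eq; rewrite /hull; cbn [left_ right_ bot top]; lia.
  - by right; right; right; right; exists i; lia.
  - by clear -hq he i0; rlia.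
  - by apply: rect_eq; rewrite /hull; cbn [left_ right_ bot top]; lia.
have := groups (Z.to_nat q); rewrite Z2Nat.id // => /(_ (Z.le_refl _)).
by rewrite /slow_grid Z.add_comm.
Qed.

Lemma slow_last_site q e t : 1 <= q -> 1 <= e ->
  evolve (slow_seed q e) t (3 * q + 2 * e) (3 * q + e) -> group_start q e q <= Z.of_nat t.
Proof.
move=> hq he ev.
have := @infection_time_ge (slow_seed q e) (slow_grid q e) (slow_time q e) t _ _ _ _ ev.
rewrite (@slow_time_group3 _ _ _ _ (q - 1)); try lia.
have := group_start_next q e (q - 1); rewrite Z.sub_add => E H.
suff : group_start q e (q - 1) + 3 * q + 1 + 3 * e + (3 * q + e) <= Z.of_nat t by lia.
apply: H => [u v|T u v T0]; first by apply: slow_seed_time; lia.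
exact: slow_time_local.
Qed.

(* 18 group_start q e q = 13 n^2 - (2 n - 9 q)^2 - O(n), so q should be close to 2 n / 9. *)
Lemma slow_parameters n : 27 <= n ->
  exists q e, [/\ 1 <= q, 1 <= e, n = 3 * q + 1 + 2 * e &
    13 * n * n - 500 * n <= 18 * group_start q e q].
Proof.
move=> hn.
have [q [e [nE hr]]] : exists q e, n = 3 * q + 1 + 2 * e /\ 0 <= 2 * n - 9 * q <= 17.
  exists ((2 * n) / 9 - (n - 1 - 3 * ((2 * n) / 9)) mod 2).
  exists ((n - 1 - 3 * ((2 * n) / 9 - (n - 1 - 3 * ((2 * n) / 9)) mod 2)) / 2).
  by Z.to_euclidean_division_equations; lia.
exists q, e; split=> //; [lia | lia |].
rewrite /group_start /odd_start.
have [r rE] : exists r, r = 2 * n - 9 * q by eexists.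
have eE : 6 * e = n - 3 + r by lia.
have qE : 9 * q = 2 * n - r by lia.
nia.
Qed.

Definition region_of {n : nat} (s : Z) (A : {set site n}) : region := fun x y =>
  exists v : site n, [/\ v \in A, x = Z.of_nat v.1 & y = Z.of_nat v.2 - s].

Definition square (n : nat) (s : Z) : rect := Rect 0 (Z.of_nat n - 1) (- s) (Z.of_nat n - 1 - s).

Lemma adjacentE (n : nat) (u v : site n) : Defs.adjacent u v <->
  Z.abs (Z.of_nat u.1 - Z.of_nat v.1) + Z.abs (Z.of_nat u.2 - Z.of_nat v.2) = 1.
Proof.
rewrite /Defs.adjacent /l1_dist -!plusE -!minusE.
by split=> [/eqP|] h; [| apply/eqP]; lia.
Qed.

Lemma site_inj (n : nat) (u v : site n) : u.1 = v.1 :> nat -> u.2 = v.2 :> nat -> u = v.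
Proof. by case: u v => [u1 u2] [v1 v2] /= /ord_inj -> /ord_inj ->. Qed.

Lemma site_inside {n : nat} s (v : site n) :
  inside (square n s) (Z.of_nat v.1) (Z.of_nat v.2 - s).
Proof.
have /ltP h1 := ltn_ord v.1; have /ltP h2 := ltn_ord v.2.
by rewrite /square; split; cbn [left_ right_ bot top]; lia.
Qed.

Lemma region_of_inside {n : nat} {s} {A : {set site n}} {x y} :
  region_of s A x y -> inside (square n s) x y.
Proof. by move=> [v [_ -> ->]]; apply: site_inside. Qed.

Lemma site_of_inside {n : nat} {s x y} : inside (square n s) x y ->
  exists v : site n, x = Z.of_nat v.1 /\ y = Z.of_nat v.2 - s.
Proof.
rewrite /square => -[]; cbn [left_ right_ bot top] => hx hy.
have h1 : (Z.to_nat x < n)%nat by apply/ltP; lia.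
have h2 : (Z.to_nat (y + s) < n)%nat by apply/ltP; lia.
by exists (Ordinal h1, Ordinal h2); cbn [fst snd nat_of_ord]; lia.
Qed.

Lemma region_of_site {n : nat} s (A : {set site n}) (v : site n) :
  region_of s A (Z.of_nat v.1) (Z.of_nat v.2 - s) <-> v \in A.
Proof.
split=> [[w [wA e1 e2]]|vA]; last by exists v.
by have -> : v = w by apply: site_inj; lia.
Qed.

Lemma region_of_step (n : nat) s (A : {set site n}) x y :
  region_of s (bootstrap_step A) x y <-> region_of s A x y \/ two_neighbours (region_of s A) x y.
Proof.
split.
- move=> [v [+ -> ->]]; rewrite !inE => /orP[vA|]; first by left; exists v.
  case/card_gt1P => w1 [w2 []]; rewrite !inE.
  move=> /andP[w1A /adjacentE a1] /andP[w2A /adjacentE a2] /eqP nw; right.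
  have {}nw : Z.of_nat w1.1 <> Z.of_nat w2.1 \/ Z.of_nat w1.2 <> Z.of_nat w2.2.
    by apply: NNPP => h; apply: nw; apply: site_inj; lia.
  have r1 := proj2 (region_of_site s A w1) w1A; have r2 := proj2 (region_of_site s A w2) w2A.
  have dir a b c d : Z.abs (a - c) + Z.abs (b - d) = 1 ->
      (c = a - 1 /\ d - s = b - s) \/ (c = a + 1 /\ d - s = b - s) \/
      (c = a /\ d - s = b - s - 1) \/ (c = a /\ d - s = b - s + 1) by clear; lia.
  case: (dir _ _ _ _ a1) => [|[|[|]]] [p1 p2]; case: (dir _ _ _ _ a2) => [|[|[|]]] [q1 q2];
    rewrite p1 p2 in r1; rewrite q1 q2 in r2; rewrite /two_neighbours; try (by lia); tauto.
- case=> [[v [vA -> ->]]|tn]; first by exists v; rewrite !inE vA.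
  have [u [v [u' [v' [r1 r2 [d1 d2 d3]]]]]] : exists u v u' v', [/\ region_of s A u v,
     region_of s A u' v' & [/\ Z.abs (x - u) + Z.abs (y - v) = 1,
     Z.abs (x - u') + Z.abs (y - v') = 1 & (u <> u' \/ v <> v') /\
     Z.min u u' <= x <= Z.max u u' /\ Z.min v v' <= y <= Z.max v v']].
    by case: tn => [[h1 h2]|[[h1 h2]|[[h1|h1] [h2|h2]]]];
      do 4 eexists; (split; [exact: h1 | exact: h2 | split; lia]).
  have i1 := region_of_inside r1; have i2 := region_of_inside r2.
  have inxy : inside (square n s) x y by rewrite /square in i1 i2 *; rlia.
  have [z [xE yE]] := site_of_inside inxy.
  exists z; split=> //; rewrite !inE; apply/orP; right.
  case: r1 => [w1 [w1A e1 e1']]; case: r2 => [w2 [w2A e2 e2']].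
  apply/card_gt1P; exists w1, w2; split.
  + by rewrite inE w1A; apply/adjacentE; clear -xE yE e1 e1' d1; lia.
  + by rewrite inE w2A; apply/adjacentE; clear -xE yE e2 e2' d2; lia.
  + by apply/eqP => w12; rewrite w12 in e1 e1'; lia.
Qed.

Lemma evolve_region_of (n : nat) s (A : {set site n}) t x y :
  evolve (region_of s A) t x y <-> region_of s (infected A t) x y.
Proof.
elim: t x y => [|t IHt] x y //=.
rewrite region_of_step /two_neighbours !IHt; tauto.
Qed.

Lemma infectedE {n : nat} s (A : {set site n}) t (v : site n) :
  v \in infected A t <-> evolve (region_of s A) t (Z.of_nat v.1) (Z.of_nat v.2 - s).
Proof. by rewrite evolve_region_of region_of_site. Qed.

Lemma at_time_within_square (n : nat) s (A : {set site n}) T x y :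
  at_time (within (region_of s A) (square n s)) T x y <-> at_time (region_of s A) T x y.
Proof.
split; apply: at_time_mono => u v; first by case.
by move=> Auv; split; last exact: region_of_inside Auv.
Qed.

Lemma percolates_spanned {n : nat} s (A : {set site n}) :
  percolates A <-> spanned (region_of s A) (square n s).
Proof.
split=> [/percolation_timeP[inf _]|[T sp] v].
  exists (Z.of_nat (percolation_time A)) => x y /site_of_inside[v [-> ->]].
  apply/at_time_within_square.
  by rewrite /at_time Nat2Z.id; apply/infectedE; rewrite inf inE.
exists (Z.to_nat T); apply/(infectedE s A).
by apply/at_time_within_square; apply: sp; apply: site_inside.
Qed.

Lemma max_percolation_time_le (n : nat) : (0 < n)%nat ->
  18 * Z.of_nat (max_percolation_time n) <= 13 * Z.of_nat n * Z.of_nat n + 1000 * Z.of_nat n.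
Proof.
move=> /ltP n0; have [[A [pA <-]] _] := max_percolation_timeP n.
have [_ minT] := percolation_timeP pA.
have ne : nonempty (square n 0) by rewrite /square /nonempty /=; lia.
have [T [T0 TB sp]] := spanned_in_budget _ _ ne (proj1 (percolates_spanned 0 A) pA).
have {minT} : (percolation_time A <= Z.to_nat T)%nat.
  apply: minT; apply/setP => v; rewrite inE; apply/(infectedE 0 A).
  by apply/at_time_within_square; apply: sp; apply: site_inside.
move/leP => le.
have bE : budget (square n 0) = 13 * Z.of_nat n * Z.of_nat n + 1000 * Z.of_nat n.
  rewrite /budget /semiper.
  have -> : width (square n 0) = Z.of_nat n by rewrite /square; rlia.
  have -> : height (square n 0) = Z.of_nat n by rewrite /square; rlia.
  by rewrite /Gtime Z.max_id Z.min_id Z.max_l; lia.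
lia.
Qed.

Lemma max_percolation_time_ge (n : nat) : (27 <= n)%nat ->
  13 * Z.of_nat n * Z.of_nat n - 500 * Z.of_nat n <= 18 * Z.of_nat (max_percolation_time n).
Proof.
move=> /leP n27; have [q [e [q1 e1 nE le]]] := @slow_parameters (Z.of_nat n) ltac:(lia).
pose A : {set site n} :=
  [set v : site n | `[< slow_seed q e (Z.of_nat v.1) (Z.of_nat v.2 - e) >]].
have gridE : slow_grid q e = square n e.
  by apply: rect_eq; rewrite /slow_grid /square; cbn [left_ right_ bot top]; lia.
have AE x y : region_of e A x y <-> slow_seed q e x y.
  split=> [[v [+ -> ->]]|sd]; first by rewrite inE => /asboolP.
  have [inxy _] := @slow_seed_time q e x y ltac:(lia) ltac:(lia) sd.
  rewrite gridE in inxy; have [v [xE yE]] := site_of_inside inxy.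
  by exists v; split=> //; rewrite inE; apply/asboolP; rewrite -xE -yE.
have pA : percolates A.
  apply/(percolates_spanned e A); rewrite -gridE.
  have [T sp] := @slow_spanned q e ltac:(lia) ltac:(lia).
  by exists T => x y /sp; apply: at_time_mono => u v [/AE Auv inuv].
have [inf _] := percolation_timeP pA.
have [_ /(_ A pA) /leP maxT] := max_percolation_timeP n.
have /site_of_inside[v [xE yE]] : inside (square n e) (3 * q + 2 * e) (3 * q + e).
  by rewrite /square; rlia.
have : v \in infected A (percolation_time A) by rewrite inf inE.
move/(infectedE e A); rewrite -xE -yE => ev.
have := @slow_last_site q e (percolation_time A) q1 e1.
have ev' : evolve (slow_seed q e) (percolation_time A) (3 * q + 2 * e) (3 * q + e).
  by apply: evolve_mono ev => u w /AE.
by move=> /(_ ev'); lia.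
Qed.

Import Order.TTheory GRing.Theory Num.Theory.
Local Close Scope Z_scope.
Local Open Scope classical_set_scope.
Local Open Scope ring_scope.

Theorem theorem1 (R : realType) :
  (fun n : nat => (max_percolation_time n)%:R : R) =
    (fun n : nat => 13 / 18 * n%:R ^+ 2 : R) +O_\oo (fun n : nat => n%:R : R).
Proof.
have [c cE] : exists c : R, c = 1000%:R by eexists.
apply/eqaddOP; near=> k; near=> n.
have n27 : (27 <= n)%nat by near: n; exact: nbhs_infty_ge.
have ck : c <= k by near: k; apply: nbhs_pinfty_ge; apply: num_real.
set M := max_percolation_time n.
have upper : 18 * M%:R <= 13 * (n%:R * n%:R) + c * n%:R.
  rewrite cE -!natrM -natrD ler_nat.
  have le := max_percolation_time_le n (leq_trans (isT : (0 < 27)%nat) n27).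
  by apply/ssrnat.leP; rewrite -/M -!multE -!plusE in le *; lia.
have lower : 13 * (n%:R * n%:R) <= 18 * M%:R + c * n%:R.
  rewrite cE -!natrM -natrD ler_nat; have le := max_percolation_time_ge n n27.
  by apply/ssrnat.leP; rewrite -/M -!multE -!plusE in le *; lia.
have cn0 : 0 <= c * n%:R by rewrite cE -natrM ler0n.
have cn : c * n%:R <= k * n%:R by rewrite ler_wpM2r.
rewrite [X in `|X|](_ : _ = M%:R - 13 / 18 * n%:R ^+ 2) //.
rewrite [`|n%:R|]ger0_norm // ler_norml expr2.
move: upper lower cn cn0; move: (M%:R) (n%:R * n%:R) (c * n%:R) (k * n%:R).
by move=> m nn d kn upper lower d_le d_ge0; apply/andP; split; lra.
Unshelve. all: end_near. Qed.
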